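(* Let $J=M_{1,1}^+$. Every block of the category $J\text{-mod}_{\frac12}$ of finite-dimensional special $J$-bimodules is equivalent to the category of finite-dimensional $\mathbb C[x,y]$-modules with nilpotent action of $x$ and $y$.
   Context: All spaces are over $\mathbb C$. $M_{1,1}=\operatorname{End}(\mathbb C^{1|1})$ is the associative superalgebra of $2\times2$ matrices (diagonal matrices even, off-diagonal odd), and $M_{1,1}^+$ is the Jordan superalgebra on the same superspace with product $a\cdot b=\frac12(ab+(-1)^{|a||b|}ba)$. A $J$-bimodule is a superspace $M$ with a parity-preserving linear map $J\otimes M\to M$ such that $J\oplus M$, with the product of $J$ extended by $a\cdot v=(-1)^{|a||v|}v\cdot a$ and $M\cdot M=0$, is a Jordan superalgebra. It is special (one-sided) if the identity of $J$ acts as $\frac12\operatorname{id}$. Morphisms are parity-preserving; a block is an indecomposable direct summand of the category. *)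

(* Defs.v *)
From HB Require Import structures.
From mathcomp Require Import all_boot all_order all_algebra.
From mathcomp Require Import boolp reals complex mpoly ring.

Set Implicit Arguments.
Unset Strict Implicit.
Unset Printing Implicit Defensive.

Import GRing.Theory Num.Theory.
Local Open Scope ring_scope.

Section Submodules.
Variables (F : fieldType) (V : lmodType F).

Record submod := Submod {
  submod_pred :> V -> Prop;
  submod_pred0 : submod_pred 0;
  submod_predP : forall (k : F) (u v : V),
    submod_pred u -> submod_pred v -> submod_pred (k *: u + v)
}.

Definition in_submod (S : submod) : {pred V} := fun v => `[< S v >].

Lemma in_submod_closed S : submod_closed (in_submod S).
Proof.
split=> [|k u v /asboolP Su /asboolP Sv]; apply/asboolP.
  exact: submod_pred0.
exact: submod_predP.
Qed.

HB.instance Definition _ S :=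
  GRing.isSubmodClosed.Build F V (in_submod S) (in_submod_closed S).

Record submod_of (S : submod) : predArgType :=
  SubmodOf { submod_val : V; submod_valP : submod_val \in in_submod S }.

HB.instance Definition _ S := [isSub of submod_of S for @submod_val S].
HB.instance Definition _ S := [Choice of submod_of S by <:].
HB.instance Definition _ S := [SubChoice_isSubZmodule of submod_of S by <:].
HB.instance Definition _ S := [SubZmodule_isSubLmodule of submod_of S by <:].

Definition mk_submod_of (S : submod) (v : V) (Sv : S v) : submod_of S :=
  SubmodOf (asboolT Sv).

Lemma submod_ofP (S : submod) (f : submod_of S) : S (submod_val f).
Proof. exact/asboolP/submod_valP. Qed.

End Submodules.

Definition bilin (F : fieldType) (U V W : lmodType F) (m : U -> V -> W) : Prop :=
  (forall u, linear (m u)) /\ (forall v, linear (m^~ v)).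

Lemma bilin0r (F : fieldType) (U V W : lmodType F) (m : U -> V -> W) u :
  bilin m -> m u 0 = 0.
Proof.
by case=> mr _; have := mr u (-1) 0 0; rewrite scaler0 add0r scaleN1r addNr.
Qed.

Lemma bilin0l (F : fieldType) (U V W : lmodType F) (m : U -> V -> W) v :
  bilin m -> m 0 v = 0.
Proof.
by case=> _ ml; have := ml v (-1) 0 0; rewrite scaler0 add0r scaleN1r addNr.
Qed.

Record lincat (F : fieldType) := LinCat {
  ob :> Type;
  hom : ob -> ob -> lmodType F;
  idm : forall X, hom X X;
  comp : forall X Y Z, hom Y Z -> hom X Y -> hom X Z;
  comp_bilin : forall X Y Z, bilin (@comp X Y Z);
  compA : forall X Y Z T (h : hom Z T) (g : hom Y Z) (f : hom X Y),
    comp h (comp g f) = comp (comp h g) f;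
  comp1m : forall X Y (f : hom X Y), comp (idm Y) f = f;
  compm1 : forall X Y (f : hom X Y), comp f (idm X) = f
}.

Arguments hom {F C} X Y : rename.
Arguments idm {F C} X : rename.
Arguments comp {F C X Y Z} g f : rename.

Definition fullsub (F : fieldType) (C : lincat F) (P : C -> Prop) : lincat F :=
  @LinCat F {X : C | P X} (fun X Y => hom (sval X) (sval Y))
    (fun X => idm (sval X)) (fun X Y Z g f => comp g f)
    (fun X Y Z => comp_bilin (sval X) (sval Y) (sval Z))
    (fun X Y Z T h g f => compA h g f)
    (fun X Y f => comp1m f) (fun X Y f => compm1 f).

Section Categories.
Variable F : fieldType.

Definition is_iso (C : lincat F) (X Y : C) (f : hom X Y) : Prop :=
  exists g : hom Y X, comp g f = idm X /\ comp f g = idm Y.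

Definition isomorphic (C : lincat F) (X Y : C) : Prop :=
  exists f : hom X Y, is_iso f.

Definition zero_ob (C : lincat F) (X : C) : Prop := idm X = 0.

Definition biproduct (C : lincat F) (X Y Z : C) : Prop :=
  exists (i1 : hom X Z) (i2 : hom Y Z) (p1 : hom Z X) (p2 : hom Z Y),
  [/\ comp p1 i1 = idm X, comp p2 i2 = idm Y,
      comp p1 i2 = 0, comp p2 i1 = 0 &
      comp i1 p1 + comp i2 p2 = idm Z].

Definition replete (C : lincat F) (P : C -> Prop) : Prop :=
  forall X Y : C, isomorphic X Y -> P X -> P Y.

(* A full replete subcategory is given by the predicate of its objects. *)
Definition direct_sum (C : lincat F) (P Q : C -> Prop) : Prop :=
  [/\ replete P, replete Q,
      forall (X Y : C) (f : hom X Y), P X -> Q Y -> f = 0,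
      forall (X Y : C) (f : hom Y X), P X -> Q Y -> f = 0 &
      forall Z : C, exists X Y : C, [/\ P X, Q Y & biproduct X Y Z]].

Definition zero_cat (C : lincat F) : Prop := forall X : C, zero_ob X.

Definition indecomposable (C : lincat F) : Prop :=
  ~ zero_cat C /\
  forall P Q : C -> Prop, direct_sum P Q ->
    zero_cat (fullsub P) \/ zero_cat (fullsub Q).

Definition is_block (C : lincat F) (B : C -> Prop) : Prop :=
  (exists B' : C -> Prop, direct_sum B B') /\ indecomposable (fullsub B).

Record lfunctor (C D : lincat F) := LFunctor {
  fob :> C -> D;
  fmap : forall X Y : C, hom X Y -> hom (fob X) (fob Y);
  fmap_linear : forall X Y, linear (@fmap X Y);
  fmap1 : forall X, fmap (idm X) = idm (fob X);
  fmapM : forall X Y Z (g : hom Y Z) (f : hom X Y),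
    fmap (comp g f) = comp (fmap g) (fmap f)
}.

Definition idf (C : lincat F) : lfunctor C C :=
  @LFunctor C C id (fun _ _ f => f) (fun _ _ _ _ _ => erefl)
    (fun _ => erefl) (fun _ _ _ _ _ => erefl).

Lemma fcomp_linear (C D E : lincat F) (G : lfunctor D E) (H : lfunctor C D)
    (X Y : C) : linear (fun f : hom X Y => fmap G (fmap H f)).
Proof. by move=> k f g; rewrite !fmap_linear. Qed.

Lemma fcomp1 (C D E : lincat F) (G : lfunctor D E) (H : lfunctor C D) (X : C) :
  fmap G (fmap H (idm X)) = idm (G (H X)).
Proof. by rewrite !fmap1. Qed.

Lemma fcompM (C D E : lincat F) (G : lfunctor D E) (H : lfunctor C D)
    (X Y Z : C) (g : hom Y Z) (f : hom X Y) :
  fmap G (fmap H (comp g f)) = comp (fmap G (fmap H g)) (fmap G (fmap H f)).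
Proof. by rewrite !fmapM. Qed.

Definition fcomp (C D E : lincat F) (G : lfunctor D E) (H : lfunctor C D) :
    lfunctor C E :=
  @LFunctor C E (fun X => G (H X)) (fun _ _ f => fmap G (fmap H f))
    (fcomp_linear G H) (fcomp1 G H) (fcompM G H).

Definition nat_iso (C D : lincat F) (G H : lfunctor C D) : Prop :=
  exists eta : forall X, hom (G X) (H X),
    (forall X Y (f : hom X Y), comp (eta Y) (fmap G f) = comp (fmap H f) (eta X))
    /\ (forall X, is_iso (eta X)).

Definition equivalent (C D : lincat F) : Prop :=
  exists (G : lfunctor C D) (H : lfunctor D C),
    nat_iso (fcomp H G) (idf C) /\ nat_iso (fcomp G H) (idf D).

End Categories.

(* The parity is a boolean: [false] is even and [true] is odd, so that the
   addition of parities is [addb] and their product is [andb]. *)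
Record superspace (F : fieldType) := SuperSpace {
  ss_space :> vectType F;
  part : bool -> {vspace ss_space};
  part_cap : (part false :&: part true = 0)%VS;
  part_add : (part false + part true = fullv)%VS
}.

Section Super.
Variable F : fieldType.

Definition hcomp (V : superspace F) (p : bool) : 'End(V) :=
  daddv_pi (part V p) (part V (~~ p)).

Lemma hcomp_id (V : superspace F) p v : v \in part V p -> hcomp V p v = v.
Proof.
by move=> Vv; rewrite /hcomp daddv_pi_id //; case: p {Vv};
  rewrite ?[(part V true :&: _)%VS]capvC part_cap.
Qed.

Lemma hcomp_neg (V : superspace F) p v : v \in part V p -> hcomp V (~~ p) v = 0.
Proof.
move=> Vv; have cap0 q : (part V q :&: part V (~~ q) = 0)%VS.
  by case: q; rewrite ?[(part V true :&: _)%VS]capvC part_cap.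
have /(_ v) := @daddv_pi_add _ _ (part V p) (part V (~~ p)) _ (cap0 p).
have -> : (part V p + part V (~~ p) = fullv)%VS.
  by case: p {Vv}; rewrite ?[(part V true + _)%VS]addvC part_add.
rewrite /hcomp negbK memvf => /(_ isT).
rewrite (daddv_pi_id (cap0 p) Vv) => /(canRL (addKr _)) ->.
by rewrite addNr.
Qed.

Definition direct_sum_part (U V : superspace F) (p : bool) :
    {vspace (U * V)%type} :=
  ((linfun (fst : U * V -> U) @^-1: part U p) :&:
   (linfun (snd : U * V -> V) @^-1: part V p))%VS.

Lemma mem_direct_sum_part (U V : superspace F) p (w : U * V) :
  (w \in direct_sum_part U V p) = (w.1 \in part U p) && (w.2 \in part V p).
Proof. by rewrite memv_cap -!memv_preim !lfunE. Qed.

Lemma direct_sum_cap (U V : superspace F) :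
  (direct_sum_part U V false :&: direct_sum_part U V true = 0)%VS.
Proof.
apply/eqP; rewrite -subv0; apply/subvP=> -[u v].
rewrite memv_cap !mem_direct_sum_part /= => /andP[/andP[u0 v0] /andP[u1 v1]].
have := memv_cap u (part U false) (part U true).
rewrite u0 u1 part_cap memv0 => /eqP ->.
have := memv_cap v (part V false) (part V true).
by rewrite v0 v1 part_cap memv0 => /eqP ->; rewrite mem0v.
Qed.

Lemma direct_sum_add (U V : superspace F) :
  (direct_sum_part U V false + direct_sum_part U V true = fullv)%VS.
Proof.
apply/eqP; rewrite eqEsubv subvf; apply/subvP=> -[u v] _.
have := memvf u; rewrite -part_add => /memv_addP[u0 Uu0 [u1 Uu1 ->]].
have := memvf v; rewrite -part_add => /memv_addP[v0 Vv0 [v1 Vv1 ->]].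
rewrite [X in X \in _](_ : _ = (u0, v0) + (u1, v1)) //.
by apply: memv_add; rewrite mem_direct_sum_part /= ?Uu0 ?Uu1 ?Vv0 ?Vv1.
Qed.

Definition ss_sum (U V : superspace F) : superspace F :=
  SuperSpace (direct_sum_cap U V) (direct_sum_add U V).

(* The last clause is the full linearization of (x^2 y) x = x^2 (y x), with the
   signs given by the Koszul rule; in characteristic 0 it is equivalent to the
   Jordan identity for the Grassmann envelope. *)
Definition is_jordan (V : superspace F) (mul : V -> V -> V) : Prop :=
  let sg (b : bool) : F := (-1) ^+ b in
  [/\ bilin mul,
      forall (p q : bool) (a b : V), a \in part V p -> b \in part V q ->
        mul a b \in part V (p (+) q),
      forall (p q : bool) (a b : V), a \in part V p -> b \in part V q ->
        mul a b = sg (p && q) *: mul b a &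
      forall (p q r s : bool) (a b c d : V),
        a \in part V p -> b \in part V q -> c \in part V r -> d \in part V s ->
        mul (mul (mul a b) c) d
        + sg ((q && r) (+) (q && s) (+) (r && s)) *: mul (mul (mul a d) c) b
        + sg ((p && q) (+) (p && r) (+) (p && s) (+) (r && s))
            *: mul (mul (mul b d) c) a
        = mul (mul a b) (mul c d)
          + sg (q && r) *: mul (mul a c) (mul b d)
          + sg ((q && s) (+) (r && s)) *: mul (mul a d) (mul b c)].

Record unital_jordan := UnitalJordan {
  jspace :> superspace F;
  jmul : jspace -> jspace -> jspace;
  jone : jspace;
  jmulP : is_jordan jmul;
  jone_even : jone \in part jspace false;
  jmul1 : forall a, jmul jone a = a
}.

(* The product of J + M extending that of J, with a.v given by [act],
   v.a = (-1)^(|a||v|) a.v and M.M = 0. *)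
Definition null_ext_mul (J : unital_jordan) (M : superspace F)
    (act : J -> M -> M) (x y : ss_sum J M) : ss_sum J M :=
  (jmul x.1 y.1,
   act x.1 y.2
   + \sum_(p : bool) \sum_(q : bool)
       (-1) ^+ (p && q) *: act (hcomp J p y.1) (hcomp M q x.2)).

Record bimodule (J : unital_jordan) := Bimodule {
  bm_space :> superspace F;
  bm_act : J -> bm_space -> bm_space;
  bm_bilin : bilin bm_act;
  bm_parity : forall (p q : bool) (a : J) (v : bm_space),
    a \in part J p -> v \in part bm_space q ->
    bm_act a v \in part bm_space (p (+) q);
  bm_jordan : is_jordan (null_ext_mul bm_act)
}.

Definition bimod_morphism (J : unital_jordan) (M N : bimodule J)
    (f : 'Hom(M, N)) : Prop :=
  (forall (p : bool) (v : M), v \in part M p -> f v \in part N p) /\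
  (forall (a : J) (v : M), f (bm_act a v) = bm_act a (f v)).

Section BimodCat.
Variable J : unital_jordan.
Implicit Types M N P : bimodule J.

Lemma bimod_morphism0 M N : bimod_morphism (0 : 'Hom(M, N)).
Proof.
split=> [p v _|a v]; rewrite !lfunE /= ?mem0v //.
by rewrite (bilin0r _ (bm_bilin N)).
Qed.

Lemma bimod_morphismP M N (k : F) (f g : 'Hom(M, N)) :
  bimod_morphism f -> bimod_morphism g -> bimod_morphism (k *: f + g).
Proof.
move=> [fp fa] [gp ga]; split=> [p v Mv|a v].
  by rewrite !lfunE /= lfunE /= rpredD ?rpredZ ?fp ?gp.
by rewrite !lfunE /= !lfunE /= fa ga (bm_bilin N).1.
Qed.

Definition bimod_submod M N : submod 'Hom(M, N) :=
  Submod (@bimod_morphism0 M N) (@bimod_morphismP M N).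

Definition bimod_hom M N : lmodType F := submod_of (bimod_submod M N).

Lemma bimod_id_morphism M : bimod_morphism (\1 : 'End(M))%VF.
Proof. by split=> [p v|a v]; rewrite !lfunE. Qed.

Lemma bimod_comp_morphism M N P (g : bimod_hom N P) (f : bimod_hom M N) :
  bimod_morphism (submod_val g \o submod_val f)%VF.
Proof.
have [gp ga] := submod_ofP g; have [fp fa] := submod_ofP f.
split=> [p v Mv|a v]; rewrite !lfunE /=; first exact/gp/fp.
by rewrite fa ga.
Qed.

Definition bimod_id M : bimod_hom M M := 
  mk_submod_of (S := bimod_submod M M) (bimod_id_morphism M).

Definition bimod_comp M N P (g : bimod_hom N P) (f : bimod_hom M N) :
    bimod_hom M P :=
  mk_submod_of (S := bimod_submod M P) (bimod_comp_morphism g f).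

Lemma bimod_comp_bilin M N P : bilin (@bimod_comp M N P).
Proof.
split=> [g k f1 f2|f k g1 g2]; apply: val_inj => /=.
  by rewrite comp_lfunDr comp_lfunZr.
by rewrite comp_lfunDl comp_lfunZl.
Qed.

Lemma bimod_compA M N P Q (h : bimod_hom P Q) (g : bimod_hom N P)
    (f : bimod_hom M N) :
  bimod_comp h (bimod_comp g f) = bimod_comp (bimod_comp h g) f.
Proof. by apply: val_inj; rewrite /= comp_lfunA. Qed.

Lemma bimod_comp1m M N (f : bimod_hom M N) : bimod_comp (bimod_id N) f = f.
Proof. by apply: val_inj; rewrite /= comp_lfun1l. Qed.

Lemma bimod_compm1 M N (f : bimod_hom M N) : bimod_comp f (bimod_id M) = f.
Proof. by apply: val_inj; rewrite /= comp_lfun1r. Qed.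

Definition bimod_cat : lincat F :=
  @LinCat F (bimodule J) bimod_hom bimod_id bimod_comp
    bimod_comp_bilin bimod_compA bimod_comp1m bimod_compm1.

Definition special (M : bimodule J) : Prop :=
  forall v : M, bm_act (jone J) v = 2^-1 *: v.

Definition special_cat : lincat F := @fullsub F bimod_cat special.

End BimodCat.

(* The supersymmetrized product on a superspace with an associative product:
   a.b = (ab + (-1)^(|a||b|) ba) / 2 for a, b homogeneous, extended
   bilinearly. *)
Definition plus_mul (V : superspace F) (mul : V -> V -> V) (a b : V) : V :=
  \sum_(p : bool) \sum_(q : bool)
    2^-1 *: (mul (hcomp V p a) (hcomp V q b)
             + (-1) ^+ (p && q) *: mul (hcomp V q b) (hcomp V p a)).

Lemma plus_mulE (V : superspace F) (mul : V -> V -> V) p q a b :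
  bilin mul -> a \in part V p -> b \in part V q ->
  plus_mul mul a b = 2^-1 *: (mul a b + (-1) ^+ (p && q) *: mul b a).
Proof.
move=> mulP Va Vb; rewrite /plus_mul !big_bool /=.
have := hcomp_neg Vb; have := hcomp_id Vb.
have := hcomp_neg Va; have := hcomp_id Va.
by case: p Va => _; case: q Vb => _ /= -> -> -> ->;
  rewrite ?(bilin0r _ mulP) ?(bilin0l _ mulP) ?(scaler0, addr0, add0r).
Qed.

Lemma plus_mul_bilin (V : superspace F) (mul : V -> V -> V) :
  bilin mul -> bilin (plus_mul mul).
Proof.
move=> [mulr mull]; split=> [a|b] k u v; rewrite /plus_mul scaler_sumr -big_split;
apply: eq_bigr => p _; rewrite /= scaler_sumr -big_split; apply: eq_bigr => q _ /=;
rewrite !linearP /=; move: (hcomp V p) (hcomp V q) => f g.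
  rewrite (mulr (f a)) (mull (f a)).
  rewrite [k *: (2^-1 *: _)]scalerA [k * _]mulrC -scalerA -scalerDr; congr (_ *: _).
  rewrite !scalerDr !scalerA [k * _]mulrC addrACA; congr (_ + _).
rewrite (mulr (g b)) (mull (g b)).
rewrite [k *: (2^-1 *: _)]scalerA [k * _]mulrC -scalerA -scalerDr; congr (_ *: _).
by rewrite !scalerDr !scalerA [k * _]mulrC addrACA; congr (_ + _).
Qed.

End Super.

Section SuperSymProduct.
Variables (F : fieldType) (A : algType F) (t : F).
Definition sym_mul (e : F) (x y : A) := t *: (x * y + e *: (y * x)).
Definition expand8 (e1 e2 e3 : F) (w1 w2 w3 w4 w5 w6 w7 w8 : A) : A :=
  (t ^+ 3) *: w1 + (t ^+ 3 * e1) *: w2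
  + ((t ^+ 3 * e2) *: w3 + (t ^+ 3 * (e1 * e2)) *: w4)
  + ((t ^+ 3 * e3) *: w5 + (t ^+ 3 * (e1 * e3)) *: w6
  + ((t ^+ 3 * (e2 * e3)) *: w7 + (t ^+ 3 * (e1 * e2 * e3)) *: w8)).
Lemma sym_mul_left (e1 e2 e3 : F) (a b c d : A) :
  sym_mul e3 (sym_mul e2 (sym_mul e1 a b) c) d =
  expand8 e1 e2 e3 (a * b * c * d) (b * a * c * d) (c * a * b * d) (c * b * a * d)
   (d * a * b * c) (d * b * a * c) (d * c * a * b) (d * c * b * a).
Proof.
rewrite /sym_mul /expand8.
rewrite !(scalerDr, mulrDl, mulrDr, scalerA) -!(scalerAl, scalerAr).
rewrite !scalerA !mulrA.
by do ?congr (_ + _); congr (_ *: _); ring.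
Qed.
Lemma sym_mul_pair (e1 e2 e3 : F) (a b c d : A) :
  sym_mul e3 (sym_mul e1 a b) (sym_mul e2 c d) =
  expand8 e1 e2 e3 (a * b * c * d) (b * a * c * d) (a * b * d * c) (b * a * d * c)
   (c * d * a * b) (c * d * b * a) (d * c * a * b) (d * c * b * a).
Proof.
rewrite /sym_mul /expand8.
rewrite !(scalerDr, mulrDl, mulrDr, scalerA) -!(scalerAl, scalerAr).
rewrite !scalerA !mulrA.
rewrite [X in X + _ = _]addrACA.
by do ?congr (_ + _); congr (_ *: _); ring.
Qed.
End SuperSymProduct.

Lemma sym_mul_jordan (F : fieldType) (n : nat) (p q r s : bool) (a b c d : 'M[F]_n.+1) (t : F) :
  let sg (b : bool) : F := (-1) ^+ b in
  let mul (b : bool) (x y : 'M[F]_n.+1) := t *: (x * y + sg b *: (y * x)) in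
  mul ((p (+) q (+) r) && s) (mul ((p (+) q) && r) (mul (p && q) a b) c) d
  + sg ((q && r) (+) (q && s) (+) (r && s))
      *: mul ((p (+) s (+) r) && q) (mul ((p (+) s) && r) (mul (p && s) a d) c) b
  + sg ((p && q) (+) (p && r) (+) (p && s) (+) (r && s))
      *: mul ((q (+) s (+) r) && p) (mul ((q (+) s) && r) (mul (q && s) b d) c) a
  = mul ((p (+) q) && (r (+) s)) (mul (p && q) a b) (mul (r && s) c d)
    + sg (q && r)
        *: mul ((p (+) r) && (q (+) s)) (mul (p && r) a c) (mul (q && s) b d)
    + sg ((q && s) (+) (r && s))
        *: mul ((p (+) s) && (q (+) r)) (mul (p && s) a d) (mul (q && r) b c).
Proof.
move=> sg mul; have mulE e x y : mul e x y = sym_mul t (sg e) x y by [].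
rewrite !mulE !sym_mul_left !sym_mul_pair /expand8 {mul mulE}/sg.
do 24?[match goal with |- context [?x * ?y * ?z * ?w] =>
  move: (x * y * z * w) => ? end].
apply/matrixP=> i j; rewrite !mxE.
do ?[match goal with |- context [fun_of_matrix ?w i j] =>
  move: (w i j) => ? end].
case: p; case: q; case: r; case: s => /=.
all: by ring.
Qed.

Section M11.
Variable F : numFieldType.

Definition m11_part (p : bool) : {vspace 'M[F]_2} :=
  if p then span [:: delta_mx 0 1; delta_mx 1 0]
  else span [:: delta_mx 0 0; delta_mx 1 1].

Lemma ord2_cases (P : 'I_2 -> Prop) : P 0 -> P 1 -> forall i, P i.
Proof.
move=> P0 P1 [[|[|//]] lti].
  by rewrite (_ : Ordinal lti = 0) //; apply: val_inj.
by rewrite (_ : Ordinal lti = 1) //; apply: val_inj.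
Qed.

Lemma mx2P (A B : 'M[F]_2) :
  [/\ A 0 0 = B 0 0, A 0 1 = B 0 1, A 1 0 = B 1 0 & A 1 1 = B 1 1] -> A = B.
Proof.
case=> e00 e01 e10 e11; apply/matrixP; apply: ord2_cases; exact: ord2_cases.
Qed.

Lemma mulmx2E (A B : 'M[F]_2) i j :
  (A *m B) i j = A i 0 * B 0 j + A i 1 * B 1 j.
Proof.
rewrite mxE !big_ord_recl big_ord0 addr0.
by rewrite (_ : lift ord0 ord0 = 1) //; apply: val_inj.
Qed.

Lemma mem_m11_part p (A : 'M[F]_2) :
  (A \in m11_part p)
  = if p then (A 0 0 == 0) && (A 1 1 == 0) else (A 0 1 == 0) && (A 1 0 == 0).
Proof.
apply/idP/idP; rewrite /m11_part.
  by case: p; rewrite span_cons span_seq1 => /memv_addP[_ /vlineP[k ->]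
    [_ /vlineP[l ->] ->]]; rewrite !mxE /= !mulr0 addr0 !eqxx.
have memD (k l : F) (B C : 'M[F]_2) : k *: B + l *: C \in span [:: B; C].
  by rewrite span_cons span_seq1; apply: memv_add; apply/memvZ/memv_line.
case: p => /andP[/eqP a0 /eqP a1].
  rewrite (_ : A = A 0 1 *: delta_mx 0 1 + A 1 0 *: delta_mx 1 0) //.
  by apply: mx2P; rewrite !mxE /= ?(mulr0, mulr1, addr0, add0r).
rewrite (_ : A = A 0 0 *: delta_mx 0 0 + A 1 1 *: delta_mx 1 1) //.
by apply: mx2P; rewrite !mxE /= ?(mulr0, mulr1, addr0, add0r).
Qed.

Lemma m11_cap : (m11_part false :&: m11_part true = 0)%VS.
Proof.
apply/eqP; rewrite -subv0; apply/subvP=> A.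
rewrite memv_cap !mem_m11_part memv0.
move=> /andP[/andP[/eqP a01 /eqP a10] /andP[/eqP a00 /eqP a11]].
by apply/eqP/mx2P; rewrite a01 a10 a00 a11 !mxE.
Qed.

Lemma m11_add : (m11_part false + m11_part true = fullv)%VS.
Proof.
apply/eqP; rewrite eqEsubv subvf; apply/subvP=> A _.
rewrite (_ : A = (A 0 0 *: delta_mx 0 0 + A 1 1 *: delta_mx 1 1)
               + (A 0 1 *: delta_mx 0 1 + A 1 0 *: delta_mx 1 0)).
  by apply: memv_add; rewrite mem_m11_part !mxE /= ?(mulr0, addr0) !eqxx.
by apply: mx2P; rewrite !mxE /= ?(mulr0, mulr1, addr0, add0r).
Qed.

Definition m11 : superspace F := SuperSpace m11_cap m11_add.

Definition m11_mul : m11 -> m11 -> m11 := @mulmx F 2 2 2.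

Lemma m11_mul_bilin : bilin m11_mul.
Proof.
split=> A k B C; rewrite /m11_mul /=.
  by rewrite mulmxDr scalemxAr.
by rewrite mulmxDl scalemxAl.
Qed.

Lemma m11_mul_part p q (A B : m11) :
  A \in part m11 p -> B \in part m11 q -> m11_mul A B \in part m11 (p (+) q).
Proof.
rewrite !mem_m11_part; case: p; case: q => /= /andP[/eqP a0 /eqP a1]
  /andP[/eqP b0 /eqP b1];
by rewrite !mulmx2E ?(a0, a1, b0, b1) ?(mulr0, mul0r, addr0) !eqxx.
Qed.

Definition m11_jmul : m11 -> m11 -> m11 := plus_mul m11_mul.

Lemma m11_jmul_part p q (A B : m11) :
  A \in part m11 p -> B \in part m11 q -> m11_jmul A B \in part m11 (p (+) q).
Proof.
move=> mA mB; rewrite /m11_jmul (plus_mulE m11_mul_bilin mA mB).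
rewrite rpredZ // rpredD ?m11_mul_part // rpredZ //.
by rewrite addbC m11_mul_part.
Qed.

Lemma m11_jordan_id (p q r s : bool) (A B C D : 'M[F]_2) :
  let mul : 'M[F]_2 -> 'M[F]_2 -> 'M[F]_2 := m11_jmul in
  let sg (b : bool) : F := (-1) ^+ b in
  A \in m11_part p -> B \in m11_part q -> C \in m11_part r -> D \in m11_part s ->
  mul (mul (mul A B) C) D
  + sg ((q && r) (+) (q && s) (+) (r && s)) *: mul (mul (mul A D) C) B
  + sg ((p && q) (+) (p && r) (+) (p && s) (+) (r && s))
      *: mul (mul (mul B D) C) A
  = mul (mul A B) (mul C D)
    + sg (q && r) *: mul (mul A C) (mul B D)
    + sg ((q && s) (+) (r && s)) *: mul (mul A D) (mul B C).
Proof.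
move=> mul sg mA mB mC mD.
have jE p' q' (X Y : 'M[F]_2) : X \in m11_part p' -> Y \in m11_part q' ->
    mul X Y = sym_mul 2^-1 (sg (p' && q')) X Y.
  exact: plus_mulE m11_mul_bilin.
have jm p' q' (X Y : 'M[F]_2) : X \in m11_part p' -> Y \in m11_part q' ->
    mul X Y \in m11_part (p' (+) q').
  exact: m11_jmul_part.
move: mul jE jm => mul jE jm.
rewrite (jE _ _ _ _ (jm _ _ _ _ (jm _ _ _ _ mA mB) mC) mD).
rewrite (jE _ _ _ _ (jm _ _ _ _ (jm _ _ _ _ mA mD) mC) mB).
rewrite (jE _ _ _ _ (jm _ _ _ _ (jm _ _ _ _ mB mD) mC) mA).
rewrite (jE _ _ _ _ (jm _ _ _ _ mA mB) (jm _ _ _ _ mC mD)).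
rewrite (jE _ _ _ _ (jm _ _ _ _ mA mC) (jm _ _ _ _ mB mD)).
rewrite (jE _ _ _ _ (jm _ _ _ _ mA mD) (jm _ _ _ _ mB mC)).
rewrite (jE _ _ _ _ (jm _ _ _ _ mA mB) mC).
rewrite (jE _ _ _ _ (jm _ _ _ _ mA mD) mC).
rewrite (jE _ _ _ _ (jm _ _ _ _ mB mD) mC).
rewrite (jE _ _ _ _ mA mB) (jE _ _ _ _ mA mC) (jE _ _ _ _ mA mD).
rewrite (jE _ _ _ _ mB mC) (jE _ _ _ _ mB mD) (jE _ _ _ _ mC mD).
exact: sym_mul_jordan.
Qed.

Lemma m11_jordan : is_jordan m11_jmul.
Proof.
split.
- exact: plus_mul_bilin m11_mul_bilin.
- exact: m11_jmul_part.
- move=> p q A B mA mB.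
  rewrite /m11_jmul (plus_mulE m11_mul_bilin mA mB) (plus_mulE m11_mul_bilin mB mA).
  rewrite scalerA mulrC -scalerA; congr (_ *: _).
  by rewrite andbC scalerDr scalerA -signr_addb addbb scale1r addrC.
- exact: m11_jordan_id.
Qed.

Lemma m11_one_even : (1%:M : m11) \in part m11 false.
Proof. by rewrite mem_m11_part !mxE /= !eqxx. Qed.

Lemma m11_jmul1 (A : m11) : m11_jmul 1%:M A = A.
Proof.
have := memvf A; rewrite -(part_add m11) => /memv_addP[A0 m0 [A1 m1 ->]].
have half p (B : m11) : B \in part m11 p -> m11_jmul 1%:M B = B.
  move=> mB; rewrite /m11_jmul (plus_mulE m11_mul_bilin m11_one_even mB) /=.
  rewrite /m11_mul mul1mx mulmx1 scale1r -mulr2n -scaler_nat scalerA.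
  by rewrite mulVf ?scale1r // pnatr_eq0.
have := (plus_mul_bilin m11_mul_bilin).1 1%:M 1 A0 A1.
by rewrite !scale1r -/m11_jmul (half _ _ m0) (half _ _ m1).
Qed.

Definition m11_plus : unital_jordan F :=
  UnitalJordan m11_jordan m11_one_even m11_jmul1.

End M11.

Section FdModules.
Variables (F : fieldType) (A : algType F).

Record fdmodule := FdModule {
  fm_space :> vectType F;
  fm_act : A -> fm_space -> fm_space;
  fm_bilin : bilin fm_act;
  fm_act1 : forall v, fm_act 1 v = v;
  fm_actM : forall a b v, fm_act (a * b) v = fm_act a (fm_act b v)
}.

Implicit Types M N P : fdmodule.

Definition fdmod_morphism M N (f : 'Hom(M, N)) : Prop :=
  forall (a : A) (v : M), f (fm_act a v) = fm_act a (f v).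

Lemma fdmod_morphism0 M N : fdmod_morphism (0 : 'Hom(M, N)).
Proof. by move=> a v; rewrite !lfunE /= (bilin0r _ (fm_bilin N)). Qed.

Lemma fdmod_morphismP M N (k : F) (f g : 'Hom(M, N)) :
  fdmod_morphism f -> fdmod_morphism g -> fdmod_morphism (k *: f + g).
Proof.
by move=> fa ga a v; rewrite !lfunE /= !lfunE /= fa ga (fm_bilin N).1.
Qed.

Definition fdmod_submod M N : submod 'Hom(M, N) :=
  Submod (@fdmod_morphism0 M N) (@fdmod_morphismP M N).

Definition fdmod_hom M N : lmodType F := submod_of (fdmod_submod M N).

Lemma fdmod_id_morphism M : fdmod_morphism (\1 : 'End(M))%VF.
Proof. by move=> a v; rewrite !lfunE. Qed.

Lemma fdmod_comp_morphism M N P (g : fdmod_hom N P) (f : fdmod_hom M N) :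
  fdmod_morphism (submod_val g \o submod_val f)%VF.
Proof.
have ga := submod_ofP g; have fa := submod_ofP f.
by move=> a v; rewrite !lfunE /= fa ga.
Qed.

Definition fdmod_id M : fdmod_hom M M :=
  mk_submod_of (S := fdmod_submod M M) (@fdmod_id_morphism M).

Definition fdmod_comp M N P (g : fdmod_hom N P) (f : fdmod_hom M N) :
    fdmod_hom M P :=
  mk_submod_of (S := fdmod_submod M P) (@fdmod_comp_morphism M N P g f).

Lemma fdmod_comp_bilin M N P : bilin (@fdmod_comp M N P).
Proof.
split=> [g k f1 f2|f k g1 g2]; apply: val_inj => /=.
  by rewrite comp_lfunDr comp_lfunZr.
by rewrite comp_lfunDl comp_lfunZl.
Qed.

Lemma fdmod_compA M N P Q (h : fdmod_hom P Q) (g : fdmod_hom N P)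
    (f : fdmod_hom M N) :
  fdmod_comp h (fdmod_comp g f) = fdmod_comp (fdmod_comp h g) f.
Proof. by apply: val_inj; rewrite /= comp_lfunA. Qed.

Lemma fdmod_comp1m M N (f : fdmod_hom M N) : fdmod_comp (fdmod_id N) f = f.
Proof. by apply: val_inj; rewrite /= comp_lfun1l. Qed.

Lemma fdmod_compm1 M N (f : fdmod_hom M N) : fdmod_comp f (fdmod_id M) = f.
Proof. by apply: val_inj; rewrite /= comp_lfun1r. Qed.

Definition fdmod_cat : lincat F :=
  @LinCat F fdmodule fdmod_hom fdmod_id fdmod_comp
    fdmod_comp_bilin fdmod_compA fdmod_comp1m fdmod_compm1.

Definition acts_nilpotently M (a : A) : Prop :=
  exists n : nat, forall v : M, iter n (fm_act a) v = 0.

End FdModules.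

(* Finite-dimensional F[x, y]-modules on which x = 'X_0 and y = 'X_1 act
   nilpotently. *)
Definition nilpotent_poly2_cat (F : fieldType) : lincat F :=
  @fullsub F (fdmod_cat {mpoly F[2]}) (fun M : fdmodule {mpoly F[2]} =>
    acts_nilpotently M 'X_(0 : 'I_2) /\ acts_nilpotently M 'X_(1 : 'I_2)).

(* Main.v *)
From HB Require Import structures.
From mathcomp Require Import all_boot all_order all_algebra.
From mathcomp Require Import boolp reals complex ssrcomplements mpoly ring.
Require Import Defs.

(** Let E, A and B be twice the action of the even idempotent e11 and of the two
    odd matrix units e12 and e21 on a special bimodule M. A special bimodule is
    the same as a superspace with operators of the right parities such that
    E E = E, E A + A E = A, E B + B E = B and A B - B A = 2 E - 1
    ([special_actM], [special_jordan], [rho_clifford], [op_ob]). The operators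
    X = A^2, Y = B^2 and W = (A B + B A + 1)/2 are central and satisfy
    X Y = W (W - 1) ([central_quadric]): special bimodules live over a smooth
    affine quadric surface, and a block consists of those with a given parity
    which are concentrated at a given point of it.

    Indeed an operator which commutes with all morphisms between the objects of
    a block has a single eigenvalue on that block, since the Fitting
    decomposition splits each object and the block is indecomposable
    ([block_eigenvalue]). Applied to the product of 2 E - 1 with the parity sign,
    this shows that E is the projection onto the component of some parity p
    ([block_parity]). Applied to W, it shows that W or 1 - W is invertible on the
    whole block; replacing (A, B) by (B, -A) exchanges the two, so one may assume
    that W is invertible ([block_chart]). In this chart of the quadric
    x = W^-1 X and y = Y are coordinates, since W = 1 + x y, and they too have
    single eigenvalues x0 and y0 on the block ([block_X], [block_Y]).

    In the other direction, commuting operators x and y on a space N define a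
    special bimodule on N + N by E (u, v) = (u, 0), A (u, v) = ((1 + x y) v, x u)
    and B (u, v) = (y v, u) ([double_ob]). This functor is fully faithful, and a
    bimodule on which W is invertible is recovered in this way from its part E M,
    the other part being identified with it along B ([recognize_double]). With
    x - x0 and y - y0 nilpotent it therefore reaches every object of the block.
    Conversely all bimodules so obtained lie in the block: between two nonzero
    nilpotent modules there are nonzero morphisms ([nilpotent_nonzero_hom]),
    which exist neither to nor from the complement of the block
    ([double_in_block]). *)

Set Implicit Arguments.
Unset Strict Implicit.
Unset Printing Implicit Defensive.

Import GRing.Theory Num.Theory.
Local Open Scope ring_scope.

(** * Linear identities in a module, by reflection *)

Inductive lin_expr (F : Type) :=
  | LinVar of nat
  | LinZero
  | LinAdd of lin_expr F & lin_expr F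
  | LinOpp of lin_expr F
  | LinScale of F & lin_expr F.
Arguments LinVar {F} _.
Arguments LinZero {F}.

Section LinExpr.
Variables (F : fieldType) (V : lmodType F).

Fixpoint lin_eval (xs : seq V) (e : lin_expr F) : V :=
  match e with
  | LinVar i => nth 0 xs i
  | LinZero => 0
  | LinAdd e1 e2 => lin_eval xs e1 + lin_eval xs e2
  | LinOpp e1 => - lin_eval xs e1
  | LinScale k e1 => k *: lin_eval xs e1
  end.

Fixpoint lin_coef (i : nat) (e : lin_expr F) : F :=
  match e with
  | LinVar j => if eqn i j then 1 else 0
  | LinZero => 0
  | LinAdd e1 e2 => lin_coef i e1 + lin_coef i e2
  | LinOpp e1 => - lin_coef i e1
  | LinScale k e1 => k * lin_coef i e1
  end.

Fixpoint lin_coefs_eq (n : nat) (e1 e2 : lin_expr F) : Prop :=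
  if n is m.+1 then lin_coef m e1 = lin_coef m e2 /\ lin_coefs_eq m e1 e2
  else True.

Lemma lin_evalE xs e :
  lin_eval xs e = \sum_(i < size xs) lin_coef i e *: nth 0 xs i.
Proof.
elim: e => [j||e1 IH1 e2 IH2|e1 IH1|k e1 IH1] /=.
- have [lt_j|ge_j] := ltnP j (size xs); last first.
    rewrite nth_default // big1 // => i _; case: eqnP => [ij|]; last by rewrite scale0r.
    by move: ge_j; rewrite -ij leqNgt ltn_ord.
  rewrite (bigD1 (Ordinal lt_j)) //= -[eqn j j]/(j == j) eqxx scale1r big1 ?addr0 //.
  move=> i ne_ij; rewrite -[eqn i j]/(i == j :> nat).
  by move: ne_ij; rewrite -val_eqE /= => /negPf ->; rewrite scale0r.
- by rewrite big1 // => i _; rewrite scale0r.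
- by rewrite IH1 IH2 -big_split; apply: eq_bigr => i _; rewrite scalerDl.
- by rewrite IH1 -sumrN; apply: eq_bigr => i _; rewrite scaleNr.
- by rewrite IH1 scaler_sumr; apply: eq_bigr => i _; rewrite scalerA.
Qed.

Lemma lin_exprP xs e1 e2 :
  lin_coefs_eq (size xs) e1 e2 -> lin_eval xs e1 = lin_eval xs e2.
Proof.
rewrite !lin_evalE; elim: (size xs) => [|n IHn] /= => [_|[eqn /IHn IH]].
  by rewrite !big_ord0.
by rewrite !big_ord_recr /= IH eqn.
Qed.

End LinExpr.

(* Atoms are compared up to conversion, since the same vector may carry
   different but convertible structures. *)
Ltac lin_index x xs :=
  lazymatch xs with
  | ?y :: ?ys =>
      match goal with
      | _ => let _ := match goal with _ => unify x y end in constr:(0%N)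
      | _ => let i := lin_index x ys in constr:(S i)
      end
  end.

Ltac lin_atoms xs t :=
  lazymatch t with
  | (?a + ?b)%R => let ys := lin_atoms xs a in lin_atoms ys b
  | (- ?a)%R => lin_atoms xs a
  | (_ *: ?a)%R => lin_atoms xs a
  | 0%R => xs
  | _ => match goal with
         | _ => let _ := lin_index t xs in xs
         | _ => constr:(t :: xs)
         end
  end.

Ltac lin_reify K xs t :=
  lazymatch t with
  | (?a + ?b)%R =>
      let e1 := lin_reify K xs a in let e2 := lin_reify K xs b in
      constr:(@LinAdd K e1 e2)
  | (- ?a)%R => let e1 := lin_reify K xs a in constr:(@LinOpp K e1)
  | (?k *: ?a)%R =>
      let e1 := lin_reify K xs a in constr:(@LinScale K k e1)
  | 0%R => constr:(@LinZero K)
  | _ => let i := lin_index t xs in constr:(@LinVar K i)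
  end.

(** Vectors are only compared through their coefficients, so that what is left
    are identities in the base field. *)
Ltac lin_coefs :=
  lazymatch goal with
  | |- @eq ?V ?u ?v =>
      let K := lazymatch goal with
               | |- context [(?k *: _)%R] =>
                   let K := type of k in eval cbv beta in K
               | _ => open_constr:(_ : Type)
               end in
      let xs0 := lin_atoms (@nil V) u in
      let xs := lin_atoms xs0 v in
      let e1 := lin_reify K xs u in
      let e2 := lin_reify K xs v in
      apply: (@lin_exprP _ _ xs e1 e2);
      cbn [size lin_coefs_eq lin_coef eqn]; do ?split
  end.

Ltac lin_field := lin_coefs; by field.

(** * Linear categories, summands and blocks *)

Section LinearCategories.
Variable F : fieldType.
Implicit Types C D : lincat F.

Lemma comp0m C (X Y Z : C) (f : hom X Y) : comp (0 : hom Y Z) f = 0.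
Proof. exact: bilin0l (comp_bilin X Y Z). Qed.

Lemma compm0 C (X Y Z : C) (f : hom Y Z) : comp f (0 : hom X Y) = 0.
Proof. exact: bilin0r (comp_bilin X Y Z). Qed.

Lemma isomorphic_sym C (X Y : C) : isomorphic X Y -> isomorphic Y X.
Proof. by case=> f [g [gf fg]]; exists g, f. Qed.

Lemma zero_hom_from C (X Y : C) (f : hom X Y) : zero_ob X -> f = 0.
Proof. by move=> X0; rewrite -[f]compm1 X0 compm0. Qed.

Lemma isomorphic_zero C (X Y : C) : isomorphic X Y -> zero_ob X -> zero_ob Y.
Proof.
by case=> f [g [_ fg]] X0; rewrite /zero_ob -fg (zero_hom_from f X0) comp0m.
Qed.

Lemma biproduct_sym C (X Y Z : C) : biproduct X Y Z -> biproduct Y X Z.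
Proof.
case=> i1 [i2 [p1 [p2 [p11 p22 p12 p21 ip]]]].
by exists i2, i1, p2, p1; rewrite addrC.
Qed.

Lemma biproduct_zero C (X Y Z : C) :
  biproduct X Y Z -> zero_ob Y -> isomorphic X Z.
Proof.
case=> i1 [i2 [p1 [p2 [p11 p22 p12 p21 ip]]]] Y0.
exists i1, p1; split=> //.
by rewrite -ip (zero_hom_from i2 Y0) comp0m addr0.
Qed.

(** Were a summand [K] of [Z] to have a component [Y] in the complement of [P],
    then [Y] would be a retract of [Z] through morphisms which all vanish. *)
Lemma direct_sum_summand C (P Q : C -> Prop) (K I Z : C) :
  direct_sum P Q -> biproduct K I Z -> P Z -> P K.
Proof.
case=> rP _ _ hQP dec [iK [_ [pK [_ [pKiK _ _ _ _]]]]] PZ.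
have [X [Y [PX QY bip]]] := dec K; apply: (rP X) => //.
apply: (biproduct_zero bip).
case: bip => i1 [i2 [p1 [p2 [_ p22 _ _ _]]]].
rewrite /zero_ob -p22 -[i2]comp1m -pKiK -compA.
by rewrite (hQP _ _ (comp iK i2) PZ QY) !compm0.
Qed.

Lemma block_summands C (B : C -> Prop) (K I Z : C) :
  is_block B -> biproduct K I Z -> B Z -> B K /\ B I.
Proof.
move=> [[B' dBB'] _] bip BZ; split; first exact: direct_sum_summand dBB' bip BZ.
exact: direct_sum_summand dBB' (biproduct_sym bip) BZ.
Qed.

(** The conditions on [P] and [Q] are required on the objects of [B] only: as
    [B] contains the summands of its objects, [P] and [Q] cut out a direct sum
    decomposition of the category [B] itself. *)
Lemma block_dichotomy C (B P Q : C -> Prop) :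
    is_block B ->
    (forall X Y, B X -> B Y -> isomorphic X Y -> P X -> P Y) ->
    (forall X Y, B X -> B Y -> isomorphic X Y -> Q X -> Q Y) ->
    (forall (X Y : C) (f : hom X Y), B X -> B Y -> P X -> Q Y -> f = 0) ->
    (forall (X Y : C) (f : hom Y X), B X -> B Y -> P X -> Q Y -> f = 0) ->
    (forall Z : C, B Z ->
       exists X Y : C, biproduct X Y Z /\ (B X -> B Y -> P X /\ Q Y)) ->
  (forall X, B X -> P X -> zero_ob X) \/ (forall X, B X -> Q X -> zero_ob X).
Proof.
move=> blk rP rQ hPQ hQP dec; have [_ [_ indB]] := blk.
pose P' (X : fullsub B) := P (sval X); pose Q' (X : fullsub B) := Q (sval X).
have dPQ : direct_sum P' Q'.
  split.
  - move=> X Y [f [g fg]]; apply: rP; try exact: svalP.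
    by exists f, g.
  - move=> X Y [f [g fg]]; apply: rQ; try exact: svalP.
    by exists f, g.
  - by move=> X Y f; apply: hPQ; apply: svalP.
  - by move=> X Y f; apply: hQP; apply: svalP.
  move=> [Z BZ]; have [X [Y [bip PQ]]] := dec Z BZ.
  have [BX BY] := block_summands blk bip BZ.
  have [PX QY] := PQ BX BY.
  by exists (exist _ X BX), (exist _ Y BY).
case: (indB _ _ dPQ) => [P0|Q0]; [left=> X BX PX | right=> X BX QX].
  exact: (P0 (exist _ (exist _ X BX : fullsub B) PX)).
exact: (Q0 (exist _ (exist _ X BX : fullsub B) QX)).
Qed.

(** A quasi-inverse picks, for every [X], a preimage [g X] of [X] up to an
    isomorphism [e X], and transports morphisms along these isomorphisms; all
    the required identities hold because [H] is injective on morphisms. *)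
Lemma equivalent_of_ff_ess_surj C D (H : lfunctor D C) :
    (forall X Y : D, injective (@fmap _ _ _ H X Y)) ->
    (forall (X Y : D) (f : hom (H X) (H Y)), exists g, fmap H g = f) ->
    (forall X : C, exists N : D, isomorphic (H N) X) ->
  equivalent C D.
Proof.
move=> Hinj Hfull Hess.
have [g gP] := choice Hess.
pose e X := projT1 (cid (gP X)).
have eP X : is_iso (e X) := projT2 (cid (gP X)).
pose d X := projT1 (cid (eP X)).
have eVe X : comp (d X) (e X) = idm _ := (projT2 (cid (eP X))).1.
have eeV X : comp (e X) (d X) = idm X := (projT2 (cid (eP X))).2.
pose pre (X Y : D) (f : hom (H X) (H Y)) : hom X Y :=
  projT1 (cid (Hfull X Y f)).
have preK X Y (f : hom (H X) (H Y)) : fmap H (pre X Y f) = f.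
  exact: projT2 (cid (Hfull X Y f)).
pose Gm (X Y : C) (f : hom X Y) : hom (g X) (g Y) :=
  pre _ _ (comp (d Y) (comp f (e X))).
have HGm X Y f : fmap H (Gm X Y f) = comp (d Y) (comp f (e X)) by apply: preK.
have Gm_lin X Y : linear (Gm X Y).
  move=> k f1 f2; apply: Hinj; rewrite fmap_linear !HGm.
  by rewrite (comp_bilin _ _ _).2 (comp_bilin _ _ _).1.
have Gm1 X : Gm X X (idm X) = idm (g X).
  by apply: Hinj; rewrite HGm fmap1 comp1m eVe.
have GmM X Y Z (h : hom Y Z) (f : hom X Y) :
    Gm X Z (comp h f) = comp (Gm Y Z h) (Gm X Y f).
  apply: Hinj; rewrite fmapM !HGm -!compA; congr (comp _ (comp _ _)).
  by rewrite [RHS]compA eeV comp1m.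
pose G : lfunctor C D := LFunctor Gm_lin Gm1 GmM.
pose u (N : D) := pre (g (H N)) N (e (H N)).
have uP N : fmap H (u N) = e (H N) by apply: preK.
exists G, H; split.
  exists e; split=> [X Y f|X] /=; last by exists (d X).
  by rewrite HGm compA eeV comp1m.
exists u; split=> [X Y f|X] /=.
  by apply: Hinj; rewrite !fmapM HGm !uP compA eeV comp1m.
exists (pre _ _ (d (H X))); split; apply: Hinj; rewrite fmapM fmap1 preK uP.
  exact: eVe.
exact: eeV.
Qed.

End LinearCategories.

(** * Nilpotent endomorphisms and the Fitting decomposition *)

Section Fitting.
Variables (F : fieldType) (V : vectType F).
Implicit Types (f g : 'End(V)) (v w : V).

Definition nilp (f : V -> V) : Prop := exists k, forall v, iter k f v = 0.

Definition lfun_iter k f : 'End(V) := iter k (fun g => f \o g)%VF \1%VF.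

Lemma lfun_iterE k f v : lfun_iter k f v = iter k f v.
Proof. by elim: k => [|k IHk]; rewrite /= lfunE //= -IHk. Qed.

Lemma iter_comm (f g : V -> V) k v :
  (forall w, g (f w) = f (g w)) -> g (iter k f v) = iter k f (g v).
Proof. by move=> fg; elim: k => //= k IHk; rewrite fg IHk. Qed.

Lemma iter_linear0 f k : iter k f 0 = 0.
Proof. by elim: k => //= k ->; rewrite linear0. Qed.

(** For [k] maximizing the dimension of the kernel of [f^k], the space is the
    direct sum of that kernel and of the image of [f^k]; the projection [e]
    onto the kernel commutes with everything that commutes with [f], because
    both summands are stable under such maps. *)
Lemma fitting f : exists e : 'End(V),
  [/\ forall g, (forall v, g (f v) = f (g v)) -> forall v, g (e v) = e (g v),
      forall v, e (e v) = e v,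
      exists k, forall v, iter k f (e v) = 0 &
      forall v, e v = 0 -> f v = 0 -> v = 0].
Proof.
pose P d := `[< exists k, \dim (lker (lfun_iter k f)) = d >].
have exP : exists d, P d.
  by exists (\dim (lker (lfun_iter 0 f))); apply/asboolP; exists 0%N.
have ubP d : P d -> (d <= \dim {:V})%N.
  by case/asboolP=> k <-; apply/dimvS/subvf.
case: (ex_maxnP exP ubP) => d /asboolP[k kd] dmax.
have ker_stable j v : iter (j + k) f v = 0 -> iter k f v = 0.
  have sub : (lker (lfun_iter k f) <= lker (lfun_iter (j + k) f))%VS.
    apply/subvP=> w; rewrite !memv_ker !lfun_iterE iterD => /eqP ->.
    by rewrite iter_linear0.
  have eqk : lker (lfun_iter k f) == lker (lfun_iter (j + k) f).
    rewrite eqEdim sub kd /=; apply: dmax; apply/asboolP.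
    by exists (j + k)%N.
  move=> v0; apply/eqP; rewrite -lfun_iterE -memv_ker (eqP eqk) memv_ker.
  by rewrite lfun_iterE v0.
pose K := lker (lfun_iter k f); pose I := limg (lfun_iter k f).
have inK v : (v \in K) = (iter k f v == 0) by rewrite memv_ker lfun_iterE.
have inI v : v \in I -> exists w, v = iter k f w.
  by case/memv_imgP=> w _ ->; exists w; rewrite lfun_iterE.
have iterI w : iter k f w \in I by rewrite -lfun_iterE memv_img ?memvf.
have KI0 : (K :&: I = 0)%VS.
  apply/eqP; rewrite -subv0; apply/subvP=> v; rewrite memv_cap memv0 inK.
  case/andP=> /eqP v0 /inI[w def_v]; move: v0; rewrite def_v -iterD => /ker_stable.
  by move/eqP.
have KIT : (K + I = fullv)%VS.
  apply/eqP; rewrite eqEdim subvf /= dimv_disjoint_sum //.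
  by rewrite -(limg_ker_dim (lfun_iter k f) fullv) capfv.
pose e := daddv_pi K I.
have eK v : v \in K -> e v = v by apply: daddv_pi_id.
have dec v : e v + daddv_pi I K v = v.
  by apply: daddv_pi_add; rewrite ?KIT ?memvf.
have eI v : v \in I -> e v = 0.
  move=> Iv; apply: (addIr (daddv_pi I K v)).
  by rewrite dec add0r daddv_pi_id // capvC.
have eim v : e v \in K by apply: memv_pi.
exists e; split=> [g gf v|v||v].
- rewrite -[in RHS](dec v) linearD linearD /= [e (g (e v))]eK; last first.
    by rewrite inK -iter_comm // (eqP (_ : iter k f (e v) == 0)) ?linear0 -?inK.
  rewrite [e (g _)]eI ?addr0 //.
  by have [w ->] := inI _ (memv_pi I K v); rewrite iter_comm.
- exact/eK.
- by exists k => v; apply/eqP; rewrite -inK.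
move=> ev0 fv0; have Iv : v \in I by rewrite -(dec v) ev0 add0r memv_pi.
have Kv : v \in K.
  by rewrite inK; apply/eqP/(ker_stable 1%N); rewrite addnC iterD /= fv0 iter_linear0.
by apply/eqP; rewrite -memv0 -KI0 memv_cap Kv.
Qed.

End Fitting.

Section Eigenvector.
Import VectorInternalTheory.

Lemma exists_eigenvector (F : closedFieldType) (V : vectType F) (f : 'End(V))
    (v0 : V) :
  v0 != 0 -> exists a v, v != 0 /\ f v = a *: v.
Proof.
move=> nz0; have : size (char_poly (f2mx f)) != 1%N.
  rewrite size_char_poly eqSS; apply: contra nz0 => /eqP V0.
  have : v2r v0 = 0 by apply/rowP=> i; have := ltn_ord i; rewrite [X in (_ < X)%N]V0.
  by move=> /(canRL v2rK) ->; rewrite linear0.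
case/closed_rootP=> a; rewrite -eigenvalue_root_char => /eigenvalueP[r ra nzr].
exists a, (r2v r); split.
  by apply: contra nzr => /eqP r0; rewrite -[r]r2vK r0 linear0.
by rewrite unlock /= r2vK ra linearZ.
Qed.

End Eigenvector.

(** * Special bimodules as representations *)

(** These three instances of linearity rewrite only below a linear map, and can
    therefore be iterated together with relations between such maps. *)
Lemma lfun_linD (F : fieldType) (U V : vectType F) (f : 'Hom(U, V)) u v :
  f (u + v) = f u + f v.
Proof. exact: linearD. Qed.

Lemma lfun_linN (F : fieldType) (U V : vectType F) (f : 'Hom(U, V)) u :
  f (- u) = - f u.
Proof. exact: linearN. Qed.

Lemma lfun_linZ (F : fieldType) (U V : vectType F) (f : 'Hom(U, V)) k u :
  f (k *: u) = k *: f u.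
Proof. exact: linearZ. Qed.

Definition lfun_lin := (lfun_linD, lfun_linN, lfun_linZ).

Section SuperSpaces.
Variable F : fieldType.
Implicit Types U V : superspace F.

Lemma part_capC V p : (part V p :&: part V (~~ p) = 0)%VS.
Proof. by case: p; rewrite ?[(part V true :&: _)%VS]capvC part_cap. Qed.

Lemma part_addC V p : (part V p + part V (~~ p) = fullv)%VS.
Proof. by case: p; rewrite ?[(part V true + _)%VS]addvC part_add. Qed.

Lemma hcomp_part V p v : hcomp V p v \in part V p.
Proof. exact: memv_pi. Qed.

Lemma hcompD V v p : hcomp V p v + hcomp V (~~ p) v = v.
Proof.
rewrite /hcomp negbK; apply: daddv_pi_add; first exact: part_capC.
by rewrite part_addC memvf.
Qed.

Lemma hcompE V p q v : v \in part V q -> hcomp V p v = if p == q then v else 0.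
Proof.
move=> Vv; have := hcomp_neg Vv; have := hcomp_id Vv.
by case: p; case: q {Vv} => /=.
Qed.

Lemma hcomp_even U V (f : 'Hom(U, V)) :
    (forall p v, v \in part U p -> f v \in part V p) ->
  forall p v, f (hcomp U p v) = hcomp V p (f v).
Proof.
move=> fp p v; rewrite -[in RHS](hcompD v p) linearD linearD /=.
rewrite !(hcompE _ (fp _ _ (hcomp_part _ v))) eqxx.
by case: p; rewrite addr0.
Qed.

End SuperSpaces.

Section SpecialRep.
Variables (F : numFieldType) (J : unital_jordan F).

HB.instance Definition _ (M : bimodule J) (a : J) :=
  GRing.isLinear.Build F M M *:%R (bm_act a) ((bm_bilin M).1 a).

Section NullExtension.
Variables (M : superspace F) (act : J -> M -> M).
Hypothesis act_bilin : bilin act.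

Lemma null_ext_mulE p q (x y : ss_sum J M) :
    x \in part (ss_sum J M) p -> y \in part (ss_sum J M) q ->
  null_ext_mul act x y
  = (jmul x.1 y.1, act x.1 y.2 + (-1) ^+ (p && q) *: act y.1 x.2).
Proof.
rewrite !mem_direct_sum_part => /andP[x1 x2] /andP[y1 y2].
rewrite /null_ext_mul; congr (_, _ + _); rewrite !big_bool /=.
rewrite !(hcompE _ y1) !(hcompE _ x2).
by case: p {x1 x2}; case: q {y1 y2} => /=;
  rewrite ?(bilin0l _ act_bilin) ?(bilin0r _ act_bilin) ?scaler0 ?addr0 ?add0r.
Qed.

Lemma null_ext_mulJJ (a b : J) :
  null_ext_mul act (a, 0) (b, 0) = (jmul a b, 0).
Proof.
rewrite /null_ext_mul /= (bilin0r _ act_bilin) !big_bool /= !linear0.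
by rewrite !(bilin0r _ act_bilin) !scaler0 !addr0.
Qed.

Lemma null_ext_mulJM (a : J) (v : M) :
  null_ext_mul act (a, 0) (0, v) = (0, act a v).
Proof.
have [jbilin _ _ _] := jmulP J.
rewrite /null_ext_mul /= (bilin0r _ jbilin) !big_bool /= !linear0.
by rewrite !(bilin0r _ act_bilin) !scaler0 !addr0.
Qed.

Lemma null_ext_mulMJ p q (a : J) (v : M) :
    a \in part J p -> v \in part M q ->
  null_ext_mul act (0, v) (a, 0) = (0, (-1) ^+ (q && p) *: act a v).
Proof.
move=> Ja Mv; have [jbilin _ _ _] := jmulP J.
rewrite (@null_ext_mulE q p) ?mem_direct_sum_part ?mem0v ?Ja ?Mv //=.
by rewrite (bilin0l _ jbilin) (bilin0l _ act_bilin) add0r.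
Qed.

End NullExtension.

(** The identity is the Jordan identity for [a], [v], [1] and [d], in which [1]
    acts on the module as one half. *)
Lemma special_actM (M : bimodule J) p s (a d : J) (v : M) :
    special M -> a \in part J p -> d \in part J s ->
  bm_act (jmul a d) v
  = bm_act a (bm_act d v) + (-1) ^+ (p && s) *: bm_act d (bm_act a v).
Proof.
move=> spM Ja Jd.
suff hom q w : w \in part M q -> bm_act (jmul a d) w
    = bm_act a (bm_act d w) + (-1) ^+ (p && s) *: bm_act d (bm_act a w).
  rewrite -(hcompD v false) !linearD /= !(hom _ _ (hcomp_part _ _)).
  by rewrite addrACA.
move=> Mw; have actb := bm_bilin M; have [jbilin jpart jcomm _] := jmulP J.
have [_ _ _ /(_ p q false s (a, 0) (0, w) (jone J, 0) (d, 0))] := bm_jordan M.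
rewrite !mem_direct_sum_part /= !mem0v Ja Mw Jd jone_even /= => /(_ isT isT isT isT).
have J1 : jone J \in part J false := jone_even J.
have jmulx1 r b : b \in part J r -> jmul b (jone J) = b.
  by move=> Jb; rewrite (jcomm _ _ _ _ Jb J1) andbF scale1r jmul1.
have aw : bm_act a w \in part M (p (+) q) by apply: bm_parity.
have dw : bm_act d w \in part M (s (+) q) by apply: bm_parity.
have ad : jmul a d \in part J (p (+) s) by apply: jpart.
rewrite !(null_ext_mulJM actb, null_ext_mulJJ actb, jmul1, jmulx1 _ _ Ja,
          jmulx1 _ _ Jd, jmulx1 _ _ ad).
rewrite (null_ext_mulMJ actb J1 aw) (null_ext_mulMJ actb J1 Mw).
rewrite (null_ext_mulMJ actb Jd Mw) !spM.
have zM k u : (0, k *: u) = k *: ((0, u) : ss_sum J M).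
  by congr (_, _); rewrite scaler0.
have [jml _ _ _] := bm_jordan M.
have mZl x k y : null_ext_mul (@bm_act _ _ M) (k *: x) y
    = k *: null_ext_mul (@bm_act _ _ M) x y.
  by have := jml.2 y k x 0; rewrite (bilin0l _ jml) !addr0.
have mZr x k y : null_ext_mul (@bm_act _ _ M) x (k *: y)
    = k *: null_ext_mul (@bm_act _ _ M) x y.
  by have := jml.1 x k y 0; rewrite (bilin0r _ jml) !addr0.
rewrite !zM !(mZl, mZr) !(null_ext_mulJM actb) ?(null_ext_mulMJ actb Jd aw).
rewrite (null_ext_mulMJ actb J1 dw) ?spM !zM !(mZl, mZr).
rewrite ?(null_ext_mulMJ actb Ja dw).
move/(congr1 snd) => /= /eqP; rewrite -subr_eq0 => /eqP eq0.
(* The claim is the identity [eq0], up to the scalar that makes the coefficient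
   of the left-hand side equal to 1. *)
apply/eqP; rewrite -subr_eq0 -(scaler0 _ (2 * (-1) ^+ (q && s))) -{}eq0; apply/eqP.
by case: p {Ja aw ad}; case: q {Mw dw}; case: s {Jd} => /=; lin_field.
Qed.

End SpecialRep.

Section SpecialJordan.
Variables (F : numFieldType) (J : unital_jordan F) (M : superspace F).
Variable act : J -> M -> M.
Hypothesis act_bilin : bilin act.
Hypothesis act_part : forall p q (a : J) (v : M),
  a \in part J p -> v \in part M q -> act a v \in part M (p (+) q).
Hypothesis actM : forall p s (a d : J) (v : M),
  a \in part J p -> d \in part J s ->
  act (jmul a d) v = act a (act d v) + (-1) ^+ (p && s) *: act d (act a v).

Local Notation mul := (null_ext_mul act).

HB.instance Definition _ (a : J) :=
  GRing.isLinear.Build F M M *:%R (act a) (act_bilin.1 a).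

Lemma null_ext_bilin : bilin mul.
Proof.
have [[jr jl] _ _ _] := jmulP J; have [ar al] := act_bilin.
split=> [x k y y'|y k x x'].
  congr (_, _); rewrite /= ?jr // ar scalerDr -addrA -[in RHS]addrA; congr (_ + _).
  rewrite addrCA; congr (_ + _).
  rewrite scaler_sumr -big_split; apply: eq_bigr => p _ /=.
  rewrite scaler_sumr -big_split; apply: eq_bigr => q _ /=.
  by rewrite linearP al scalerDr !scalerA mulrC.
congr (_, _); rewrite /= ?jl // al scalerDr -addrA -[in RHS]addrA; congr (_ + _).
rewrite addrCA; congr (_ + _).
rewrite scaler_sumr -big_split; apply: eq_bigr => p _ /=.
rewrite scaler_sumr -big_split; apply: eq_bigr => q _ /=.
by rewrite linearP ar scalerDr !scalerA mulrC.
Qed.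

Lemma null_ext_part p q (x y : ss_sum J M) :
    x \in part (ss_sum J M) p -> y \in part (ss_sum J M) q ->
  mul x y \in part (ss_sum J M) (p (+) q).
Proof.
have [_ jpart _ _] := jmulP J => Vx Vy; rewrite (null_ext_mulE act_bilin Vx Vy).
move: Vx Vy; rewrite !mem_direct_sum_part => /andP[x1 x2] /andP[y1 y2] /=.
by rewrite jpart //= rpredD ?act_part // rpredZ // addbC act_part.
Qed.

Import VectorInternalTheory.

(** Makes the null extension act on the sum of the base field and [M], by twice
    the action of [J] on [M] and by sending 1 to the vector of [M]. *)
Definition border_mx (x : ss_sum J M) : 'M[F]_(1 + dim M) :=
  block_mx 0 0 (v2r x.2)^T (2 *: (lin1_mx (v2r \o act x.1 \o r2v))^T).

Lemma border_mx_linear : linear border_mx.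
Proof.
move=> k x y; rewrite /border_mx scale_block_mx add_block_mx !scaler0 !addr0.
congr (block_mx _ _ _ _); first by rewrite linearP linearP.
rewrite !scalerA [k * _]mulrC -scalerA -scalerDr; congr (_ *: _).
by apply/matrixP=> i j; rewrite !mxE /= act_bilin.2 linearP !mxE.
Qed.

HB.instance Definition _ :=
  GRing.isLinear.Build F (ss_sum J M) 'M[F]_(1 + dim M) *:%R border_mx
    border_mx_linear.

Lemma border_mx_inj2 x y : border_mx x = border_mx y -> x.2 = y.2.
Proof. by move=> /eq_block_mx[_ _ /trmx_inj /v2r_inj]. Qed.

Lemma border_mxM p q (x y : ss_sum J M) :
    x \in part (ss_sum J M) p -> y \in part (ss_sum J M) q ->
  border_mx (mul x y)
  = 2^-1 *: (border_mx x *m border_mx y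
             + (-1) ^+ (p && q) *: (border_mx y *m border_mx x)).
Proof.
move=> Vx Vy; rewrite (null_ext_mulE act_bilin Vx Vy).
rewrite /border_mx !mulmx_block !(mul0mx, mulmx0, addr0, add0r) /=.
rewrite !(scale_block_mx, add_block_mx, addr0, add0r, scaler0).
have two : 2 != 0 :> F by rewrite pnatr_eq0.
have colE a v : (lin1_mx (v2r \o act a \o r2v))^T *m (v2r v)^T = (v2r (act a v))^T.
  by rewrite -trmx_mul mul_rV_lin1 /= v2rK.
move: Vx Vy; rewrite !mem_direct_sum_part => /andP[x1 _] /andP[y1 _].
congr (block_mx _ _ _ _).
  rewrite -!scalemxAl !colE !scalerDr !scalerA mulVf // scale1r.
  by rewrite mulrAC mulVf // mul1r !linearD !linearZ.
rewrite -!scalemxAl -!scalemxAr !scalerDr !scalerA.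
rewrite [2^-1 * (-1) ^+ _]mulrC mulVf // mul1r mulfVK // [_ * 2]mulrC -scalerA -scalerDr.
congr (_ *: _); apply: (can_inj (@trmxK _ _ _)).
rewrite linearD linearZ /= !trmx_mul !trmxK; apply/row_matrixP => i.
rewrite !rowE mulmxDr -scalemxAr !mulmxA !mul_rV_lin1 /=.
by rewrite !v2rK (actM _ x1 y1) linearD linearZ.
Qed.

(** Doubling the action of [J] turns [M] into a representation by the product
    (ab + (-1)^(|a||b|) ba)/2; bordering these matrices with the vectors of [M]
    realizes the whole null extension by matrices with this product, up to
    [J] itself, so that the Jordan identity is inherited from matrices. *)
Lemma special_jordan : is_jordan mul.
Proof.
have [_ _ jcomm jid] := jmulP J.
split; [exact: null_ext_bilin | exact: null_ext_part | |].
  move=> p q x y Vx Vy.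
  rewrite (null_ext_mulE act_bilin Vx Vy) (null_ext_mulE act_bilin Vy Vx).
  move: Vx Vy; rewrite !mem_direct_sum_part => /andP[x1 _] /andP[y1 _].
  congr (_, _) => /=; first exact: jcomm.
  by rewrite scalerDr scalerA andbC -signr_addb addbb scale1r addrC.
move=> p q r s a b c d Va Vb Vc Vd.
have jm p' q' x y : x \in part (ss_sum J M) p' -> y \in part (ss_sum J M) q' ->
    mul x y \in part (ss_sum J M) (p' (+) q').
  exact: null_ext_part.
apply: injective_projections; last first.
  apply: border_mx_inj2; rewrite !(linearD, linearZ) /=.
  rewrite (border_mxM (jm _ _ _ _ (jm _ _ _ _ Va Vb) Vc) Vd).
  rewrite (border_mxM (jm _ _ _ _ (jm _ _ _ _ Va Vd) Vc) Vb).
  rewrite (border_mxM (jm _ _ _ _ (jm _ _ _ _ Vb Vd) Vc) Va).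
  rewrite (border_mxM (jm _ _ _ _ Va Vb) (jm _ _ _ _ Vc Vd)).
  rewrite (border_mxM (jm _ _ _ _ Va Vc) (jm _ _ _ _ Vb Vd)).
  rewrite (border_mxM (jm _ _ _ _ Va Vd) (jm _ _ _ _ Vb Vc)).
  rewrite (border_mxM (jm _ _ _ _ Va Vb) Vc) (border_mxM (jm _ _ _ _ Va Vd) Vc).
  rewrite (border_mxM (jm _ _ _ _ Vb Vd) Vc).
  rewrite (border_mxM Va Vb) (border_mxM Va Vc) (border_mxM Va Vd).
  rewrite (border_mxM Vb Vc) (border_mxM Vb Vd) (border_mxM Vc Vd).
  exact: sym_mul_jordan.
move: Va Vb Vc Vd; rewrite !mem_direct_sum_part.
move=> /andP[a1 _] /andP[b1 _] /andP[c1 _] /andP[d1 _].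
exact: jid.
Qed.

End SpecialJordan.

(** * Splitting special bimodules *)

Section SpecialCat.
Variables (F : numFieldType) (J : unital_jordan F).
Implicit Types M N K : special_cat J.

Lemma special_homP M N (f g : hom M N) :
  (forall v, submod_val f v = submod_val g v) -> f = g.
Proof. by move=> fg; apply/val_inj/lfunP. Qed.

Definition special_hom M N (f : 'Hom(sval M, sval N)) (fP : bimod_morphism f) :
    hom M N :=
  mk_submod_of (S := bimod_submod (sval M) (sval N)) fP.

Lemma special_compE M N K (g : hom N K) (f : hom M N) v :
  submod_val (comp g f) v = submod_val g (submod_val f v).
Proof. by rewrite /= lfunE. Qed.

Lemma special_idE M v : submod_val (idm M) v = v.
Proof. by rewrite /= lfunE. Qed.

Lemma special_hom0 M N (v : sval M) : submod_val (0 : hom M N) v = 0.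
Proof. by rewrite /= lfunE. Qed.

Lemma zero_special M : zero_ob M <-> forall v : sval M, v = 0.
Proof.
split=> [M0 v|M0]; first by rewrite -(special_idE v) M0 special_hom0.
by apply: special_homP => v; rewrite [v]M0 !linear0.
Qed.

Section Build.
Variables (V : superspace F) (act : J -> V -> V).
Hypothesis act_bilin : bilin act.
Hypothesis act_part : forall p q (a : J) (v : V),
  a \in part J p -> v \in part V q -> act a v \in part V (p (+) q).
Hypothesis actM : forall p s (a d : J) (v : V),
  a \in part J p -> d \in part J s ->
  act (jmul a d) v = act a (act d v) + (-1) ^+ (p && s) *: act d (act a v).
Hypothesis act1 : forall v, act (jone J) v = 2^-1 *: v.

Definition special_ob : special_cat J :=
  exist _ (Bimodule act_bilin act_part (special_jordan act_bilin act_part actM))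
    act1.

End Build.

Section Sub.
Variables (M : special_cat J) (e : 'End(sval M)).
Hypotheses (eP : bimod_morphism e) (ee : forall v, e (e v) = e v).
Local Notation U := (limg e).

Lemma limg_idemP v : reflect (e v = v) (v \in U).
Proof.
apply: (iffP idP) => [/memv_imgP[w _ ->]|<-]; first exact: ee.
exact/memv_img/memvf.
Qed.

Definition sub_part (p : bool) : {vspace subvs_of U} :=
  (linfun (vsval : subvs_of U -> sval M) @^-1: part (sval M) p)%VS.

Lemma mem_sub_part p u : (u \in sub_part p) = (vsval u \in part (sval M) p).
Proof. by rewrite -memv_preim lfunE. Qed.

Lemma sub_cap : (sub_part false :&: sub_part true = 0)%VS.
Proof.
apply/eqP; rewrite -subv0; apply/subvP=> u.
rewrite memv_cap !mem_sub_part memv0 => /andP[u0 u1].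
have := memv_cap (vsval u) (part (sval M) false) (part (sval M) true).
by rewrite u0 u1 part_cap memv0 -(inj_eq val_inj) linear0.
Qed.

Lemma sub_add : (sub_part false + sub_part true = fullv)%VS.
Proof.
apply/eqP; rewrite eqEsubv subvf; apply/subvP=> u _.
have Uu := subvsP u; have eu := limg_idemP _ Uu.
have Uh p : hcomp (sval M) p (vsval u) \in U.
  by apply/limg_idemP; rewrite (hcomp_even eP.1) eu.
rewrite (_ : u = vsproj U (hcomp (sval M) false (vsval u))
               + vsproj U (hcomp (sval M) true (vsval u))).
  by apply: memv_add; rewrite mem_sub_part vsprojK // hcomp_part.
by rewrite -linearD (hcompD _ false) /= vsvalK.
Qed.

Definition sub_superspace : superspace F := SuperSpace sub_cap sub_add.

Definition sub_act (a : J) (u : sub_superspace) : sub_superspace :=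
  vsproj U (bm_act a (vsval u)).

Lemma sub_actE a u : vsval (sub_act a u) = bm_act a (vsval u).
Proof.
rewrite vsprojK //; apply/limg_idemP.
by rewrite eP.2 (limg_idemP _ (subvsP u)).
Qed.

Lemma sub_act_bilin : bilin sub_act.
Proof.
have [br bl] := bm_bilin (sval M).
split=> [a|u] k x y; apply: val_inj; rewrite /= ?linearP /= !sub_actE.
  by rewrite /= br.
by rewrite bl.
Qed.

Lemma sub_act_part p q (a : J) u :
    a \in part J p -> u \in part sub_superspace q ->
  sub_act a u \in part sub_superspace (p (+) q).
Proof. by rewrite !mem_sub_part sub_actE; apply: bm_parity. Qed.

Lemma sub_actM p s (a d : J) u :
    a \in part J p -> d \in part J s ->
  sub_act (jmul a d) u
  = sub_act a (sub_act d u) + (-1) ^+ (p && s) *: sub_act d (sub_act a u).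
Proof.
move=> Ja Jd; apply: val_inj; rewrite /= !sub_actE.
exact: special_actM (svalP M) Ja Jd.
Qed.

Lemma sub_act1 u : sub_act (jone J) u = 2^-1 *: u.
Proof. by apply: val_inj; rewrite /= sub_actE (svalP M). Qed.

Definition sub_ob : special_cat J :=
  special_ob sub_act_bilin sub_act_part sub_actM sub_act1.

(** The image of [e] is stable under the parity and under [J], because [e]
    commutes with both. *)
Lemma idempotent_split : exists (K : special_cat J) (i : hom K M) (p : hom M K),
  comp p i = idm K /\ forall v, submod_val (comp i p) v = e v.
Proof.
have iP : @bimod_morphism F J (sval sub_ob) (sval M) (linfun vsval).
  split=> [p u|a u]; rewrite !lfunE /=; first by rewrite mem_sub_part.
  exact: sub_actE.
have pP : @bimod_morphism F J (sval M) (sval sub_ob)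
    (linfun (vsproj U) \o e)%VF.
  have Ue v : e v \in U by exact/memv_img/memvf.
  split=> [p v Mv|a v]; rewrite !lfunE /= lfunE /=.
    by rewrite mem_sub_part vsprojK // eP.1.
  apply: val_inj; rewrite /= sub_actE lfunE /= !vsprojK //.
  exact: eP.2.
exists sub_ob, (special_hom iP), (special_hom pP); split=> [|v].
  apply: special_homP => u; rewrite special_compE special_idE /= !lfunE /= lfunE /=.
  by rewrite (limg_idemP _ (subvsP u)) vsvalK.
by rewrite special_compE /= !lfunE /= lfunE /= vsprojK // memv_img ?memvf.
Qed.

End Sub.
End SpecialCat.

(** * Central operators on a block *)

Section FittingSplit.
Variables (F : numFieldType) (J : unital_jordan F).
Variable (M : special_cat J).

Lemma bimod_morphism_complement (e : 'End(sval M)) :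
  bimod_morphism e -> bimod_morphism (\1 - e)%VF.
Proof.
move=> eP; have := bimod_morphismP (-1) eP (bimod_id_morphism (sval M)).
by rewrite scaleN1r addrC.
Qed.

(** The Fitting projection of a morphism commutes with the parity and with [J],
    so that it is itself a morphism, and splits. *)
Lemma special_fitting (f : 'End(sval M)) :
    bimod_morphism f ->
  exists (X Y : special_cat J) (i1 : hom X M) (i2 : hom Y M)
         (p1 : hom M X) (p2 : hom M Y),
  [/\ [/\ comp p1 i1 = idm X, comp p2 i2 = idm Y,
          comp p1 i2 = 0, comp p2 i1 = 0 & comp i1 p1 + comp i2 p2 = idm M],
      exists k, forall x, iter k f (submod_val i1 x) = 0 &
      forall y, f (submod_val i2 y) = 0 -> y = 0].
Proof.
move=> fP; have [e [e_comm ee e_nil e_inj]] := fitting f.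
have eP : bimod_morphism e.
  split=> [p v Mv|a v].
    rewrite -(hcomp_id Mv) -e_comm ?hcomp_part // => w.
    by rewrite (hcomp_even fP.1).
  have := e_comm (linfun (bm_act a)) _ v; rewrite !lfunE /= => -> // w.
  by rewrite !lfunE /= fP.2.
have e'P := bimod_morphism_complement eP.
have e'E v : (\1 - e)%VF v = v - e v by rewrite !lfunE /= !lfunE.
have e'e' v : (\1 - e)%VF ((\1 - e)%VF v) = (\1 - e)%VF v.
  by rewrite !e'E linearB /= ee subrr subr0.
have [X [i1 [p1 [p11 ip1]]]] := idempotent_split eP ee.
have [Y [i2 [p2 [p22 ip2]]]] := idempotent_split e'P e'e'.
have p11v x : submod_val p1 (submod_val i1 x) = x.
  by rewrite -special_compE p11 special_idE.
have p22v y : submod_val p2 (submod_val i2 y) = y.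
  by rewrite -special_compE p22 special_idE.
have ei1 x : e (submod_val i1 x) = submod_val i1 x.
  by rewrite -ip1 special_compE p11v.
have ei2 y : e (submod_val i2 y) = 0.
  have := ip2 (submod_val i2 y); rewrite special_compE p22v e'E.
  by move/esym/eqP; rewrite subr_eq addrC -subr_eq subrr => /eqP.
have p1e v : submod_val p1 (e v) = submod_val p1 v.
  by rewrite -ip1 special_compE p11v.
exists X, Y, i1, i2, p1, p2; split.
- split=> //; apply: special_homP => v; rewrite ?special_compE ?special_hom0.
  + by rewrite -p1e ei2 linear0.
  + by rewrite -[LHS]p22v -(special_compE i2 p2) ip2 e'E ei1 subrr linear0.
  have -> : submod_val (comp i1 p1 + comp i2 p2) v
      = submod_val (comp i1 p1) v + submod_val (comp i2 p2) v by rewrite lfunE.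
  by rewrite ip1 ip2 e'E addrC subrK special_idE.
- by have [k ke] := e_nil; exists k => x; rewrite -ei1.
by move=> y /(e_inj _ (ei2 y)) y0; rewrite -[y]p22v y0 linear0.
Qed.

End FittingSplit.

(** Let [a] be an eigenvalue of [c] on some object of [B]. By Fitting, every
    object splits into one where [c] is [a] plus a nilpotent and one where
    [c] - [a] is injective; there are no nonzero morphisms between objects of
    these two kinds, and those of the first kind do not all vanish. *)
Lemma block_eigenvalue (F : numClosedFieldType) (J : unital_jordan F)
    (B : special_cat J -> Prop) (c : forall M : special_cat J, 'End(sval M)) :
    is_block B ->
    (forall M, B M -> bimod_morphism (c M)) ->
    (forall (M N : special_cat J) (f : hom M N) v, B M -> B N ->
       submod_val f (c M v) = c N (submod_val f v)) ->
  exists a : F, forall M, B M -> nilp (fun v => c M v - a *: v).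
Proof.
move=> blk cP c_nat.
have [[M0 BM0] nz0] : exists X : fullsub B, ~ zero_ob X.
  apply: contrapT => all0; case: blk.2.1 => X.
  by apply: contrapT => X0; apply: all0; exists X.
have [v0 nzv0] : exists v : sval M0, v != 0.
  apply: contrapT => all0; apply/nz0/(zero_special M0) => v.
  by apply: contrapT => /eqP nzv; apply: all0; exists v.
have [a [v1 [nzv1 cv1]]] := exists_eigenvector (c M0) nzv0.
pose f M := (c M - a *: \1)%VF.
have fE M v : f M v = c M v - a *: v.
  by rewrite add_lfunE opp_lfunE scale_lfunE id_lfunE.
have fP M : B M -> bimod_morphism (f M).
  move=> BM; rewrite /f addrC -scaleNr.
  exact/bimod_morphismP/cP/BM/bimod_id_morphism.
have f_nat M N (h : hom M N) v : B M -> B N ->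
    submod_val h (f M v) = f N (submod_val h v).
  by move=> BM BN; rewrite !fE linearB linearZ /= c_nat.
have iter_nat M N (h : hom M N) k v : B M -> B N ->
    submod_val h (iter k (f M) v) = iter k (f N) (submod_val h v).
  by move=> BM BN; elim: k => //= k <-; rewrite f_nat.
pose P M := nilp (f M); pose Q M := forall v, f M v = 0 -> v = 0.
have Qinj M k v : Q M -> iter k (f M) v = 0 -> v = 0.
  by move=> QM; elim: k => //= k IHk /QM.
have isoP (M N : special_cat J) : isomorphic M N ->
    exists (h : hom M N) (h' : hom N M),
    (forall v, submod_val h' (submod_val h v) = v) /\
    (forall v, submod_val h (submod_val h' v) = v).
  case=> h [h' [h'h hh']]; exists h, h'; split=> v.
    by rewrite -special_compE h'h special_idE.
  by rewrite -special_compE hh' special_idE.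
have rP M N : B M -> B N -> isomorphic M N -> P M -> P N.
  move=> BM BN /isoP[h [h' [_ hh']]] [k fk]; exists k => v.
  by rewrite -[v]hh' -iter_nat // fk linear0.
have rQ M N : B M -> B N -> isomorphic M N -> Q M -> Q N.
  move=> BM BN /isoP[h [h' [_ hh']]] QM v fv0.
  by rewrite -[v]hh' [submod_val h' v]QM ?linear0 // -f_nat // fv0 linear0.
have dec (Z : special_cat J) : B Z ->
    exists X Y, biproduct X Y Z /\ (B X -> B Y -> P X /\ Q Y).
  move=> BZ.
  have [X [Y [i1 [i2 [p1 [p2 [bip [k fk] f0]]]]]]] := special_fitting (fP Z BZ).
  exists X, Y; split; first by exists i1, i2, p1, p2.
  move=> BX BY; split.
    exists k => x; case: bip => p11 _ _ _ _.
    rewrite -[LHS]special_idE -p11 special_compE iter_nat // fk.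
    by rewrite linear0.
  by move=> y fy0; apply: f0; rewrite -f_nat // fy0 linear0.
have hPQ (M N : special_cat J) (h : hom M N) : B M -> B N -> P M -> Q N -> h = 0.
  move=> BM BN [k fk] QN; apply: special_homP => v; rewrite special_hom0.
  by apply: (Qinj _ k _ QN); rewrite -iter_nat // fk linear0.
have hQP (M N : special_cat J) (h : hom N M) : B M -> B N -> P M -> Q N -> h = 0.
  move=> BM BN [k fk] QN; apply: special_homP => v; rewrite special_hom0.
  (* Every vector of [N] is a value of [f]^k, whose action on [M] is zero. *)
  have kerf : lker (lfun_iter k (f N)) == 0%VS.
    rewrite -subv0; apply/subvP=> w; rewrite memv_ker lfun_iterE memv0 => /eqP.
    by move/(Qinj _ _ _ QN)/eqP.
  by rewrite -(lker0_lfunVK kerf v) lfun_iterE iter_nat // fk.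
have [P0|Q0] := block_dichotomy blk rP rQ hPQ hQP dec.
- have [X [Y [bip PQ]]] := dec M0 BM0.
  have [BX BY] := block_summands blk bip BM0.
  have [PX QY] := PQ BX BY.
  have isoY := biproduct_zero (biproduct_sym bip) (P0 X BX PX).
  have := rQ Y M0 BY BM0 isoY QY v1; rewrite fE cv1 subrr => /(_ erefl) v10.
  by rewrite v10 eqxx in nzv1.
- exists a => M BM.
  have [X [Y [bip PQ]]] := dec M BM.
  have [BX BY] := block_summands blk bip BM.
  have [PX QY] := PQ BX BY.
  have [k fk] := rP X M BX BM (biproduct_zero bip (Q0 Y BY QY)) PX.
  exists k => v; rewrite -[RHS](fk v).
  by apply: eq_iter => w; rewrite fE.
Qed.

Lemma linfunE (F : fieldType) (U V : vectType F) (f : U -> V) :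
  linear f -> linfun f =1 f.
Proof.
move=> lin_f; pose fL : {linear U -> V} :=
  HB.pack f (GRing.isLinear.Build F U V *:%R f lin_f).
exact: (lfunE fL).
Qed.

(** * The operators of a special bimodule *)

Section Clifford.
Variables (F : numFieldType) (V : vectType F) (E A B : 'End(V)).

(** Bringing words in [E], [A], [B] into the order [B], [A], [E] by these
    relations gives a normal form, so that equalities between operators reduce
    to linear equalities between such words. *)
Definition clifford : Prop :=
  [/\ forall v, E (E v) = E v,
      forall v, E (A v) = A v - A (E v),
      forall v, E (B v) = B v - B (E v) &
      forall v, A (B v) = B (A v) + (2 *: E v - v)].

Definition opW : 'End(V) := (2^-1 *: ((A \o B) + (B \o A) + \1))%VF.

Lemma opWE v : opW v = 2^-1 *: (A (B v) + B (A v) + v).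
Proof. by rewrite scale_lfunE !add_lfunE !comp_lfunE id_lfunE. Qed.

Hypothesis cl : clifford.

Let EE v : E (E v) = E v. Proof. by have [] := cl. Qed.
Let EA v : E (A v) = A v - A (E v). Proof. by have [] := cl. Qed.
Let EB v : E (B v) = B v - B (E v). Proof. by have [] := cl. Qed.
Let AB v : A (B v) = B (A v) + (2 *: E v - v). Proof. by have [] := cl. Qed.

Ltac normal_form := rewrite !(opWE, EE, EA, EB, AB, lfun_lin).

Lemma opW_E v : E (opW v) = opW (E v).
Proof. by normal_form; lin_field. Qed.

Lemma opW_A v : A (opW v) = opW (A v).
Proof. by normal_form; lin_field. Qed.

Lemma opW_B v : B (opW v) = opW (B v).
Proof. by normal_form; lin_field. Qed.

Lemma sqrA_E v : E (A (A v)) = A (A (E v)).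
Proof. by normal_form; lin_field. Qed.

Lemma sqrA_B v : B (A (A v)) = A (A (B v)).
Proof. by normal_form; lin_field. Qed.

Lemma sqrB_E v : E (B (B v)) = B (B (E v)).
Proof. by normal_form; lin_field. Qed.

Lemma sqrB_A v : A (B (B v)) = B (B (A v)).
Proof. by normal_form; lin_field. Qed.

(** The equation X Y = W (W - 1) of the quadric, where X and Y are the squares
    of [A] and [B]. *)
Lemma central_quadric v : A (A (B (B v))) = opW (opW v) - opW v.
Proof. by normal_form; lin_field. Qed.

Lemma AB_opW v : E v = v -> A (B v) = opW v.
Proof. by move=> Ev; normal_form; rewrite Ev; lin_field. Qed.

Lemma BA_opW0 v : E v = 0 -> B (A v) = opW v.
Proof. by move=> Ev; normal_form; rewrite Ev linear0; lin_field. Qed.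

End Clifford.

Section M11Rep.
Variable F : numFieldType.
Local Notation J := (m11_plus F).

(** The two coordinate charts are exchanged by the automorphism of [J] which
    maps the odd generators [a], [b] to [b], [-a]. *)
Definition gen_e : J := delta_mx 0 0 : 'M[F]_2.
Definition gen_a (s : bool) : J :=
  (if s then delta_mx 1 0 else delta_mx 0 1) : 'M[F]_2.
Definition gen_b (s : bool) : J :=
  (if s then - delta_mx 0 1 else delta_mx 1 0) : 'M[F]_2.

Definition coef_a (s : bool) (m : 'M[F]_2) : F := if s then m 1 0 else m 0 1.
Definition coef_b (s : bool) (m : 'M[F]_2) : F := if s then - m 0 1 else m 1 0.

Lemma gen_e_part : gen_e \in part J false.
Proof. by rewrite mem_m11_part !mxE /= !eqxx. Qed.

Lemma gen_a_part s : gen_a s \in part J true.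
Proof. by rewrite mem_m11_part /gen_a; case: s; rewrite !mxE /= !eqxx. Qed.

Lemma gen_b_part s : gen_b s \in part J true.
Proof. by rewrite mem_m11_part /gen_b; case: s; rewrite !mxE /= ?oppr0 !eqxx. Qed.

Lemma jmulE p q (x y : J) i j : x \in part J p -> y \in part J q ->
  (jmul x y : 'M[F]_2) i j
  = 2^-1 * (x i 0 * y 0 j + x i 1 * y 1 j
            + (-1) ^+ (p && q) * (y i 0 * x 0 j + y i 1 * x 1 j)).
Proof.
move=> Jx Jy; rewrite /= /m11_jmul (plus_mulE (@m11_mul_bilin F) Jx Jy).
by rewrite mxE; congr (_ * _); rewrite mxE mulmx2E mxE mulmx2E.
Qed.

Lemma jmul_ee : jmul gen_e gen_e = gen_e.
Proof.
by apply: mx2P; rewrite !(jmulE _ _ gen_e_part gen_e_part) !mxE /=; split; field.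
Qed.

Lemma jmul_ea s : jmul gen_e (gen_a s) = 2^-1 *: gen_a s.
Proof.
apply: mx2P; rewrite !(jmulE _ _ gen_e_part (gen_a_part s)) /gen_a.
by case: s; rewrite !mxE /=; split; field.
Qed.

Lemma jmul_eb s : jmul gen_e (gen_b s) = 2^-1 *: gen_b s.
Proof.
apply: mx2P; rewrite !(jmulE _ _ gen_e_part (gen_b_part s)) /gen_b.
by case: s; rewrite !mxE /=; split; field.
Qed.

Lemma jmul_ab s : jmul (gen_a s) (gen_b s) = gen_e - 2^-1 *: jone J.
Proof.
apply: mx2P; rewrite !(jmulE _ _ (gen_a_part s) (gen_b_part s)) /gen_a /gen_b.
by case: s; rewrite !mxE /=; split; field.
Qed.

Lemma m11_basis s (m : J) :
  m = (m 0 0 - m 1 1) *: gen_e + m 1 1 *: jone J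
      + coef_a s m *: gen_a s + coef_b s m *: gen_b s.
Proof.
by case: s; apply: mx2P; rewrite !mxE /= /coef_a /coef_b; split; ring.
Qed.

Definition rho (M : bimodule J) (a : J) : 'End(M) := 2 *: linfun (bm_act a).

Lemma rhoE (M : bimodule J) a v : rho M a v = 2 *: bm_act a v.
Proof. by rewrite scale_lfunE lfunE. Qed.

Section Special.
Variables (s : bool) (M : special_cat J).
Local Notation E := (rho (sval M) gen_e).
Local Notation A := (rho (sval M) (gen_a s)).
Local Notation B := (rho (sval M) (gen_b s)).

(** The products of the generators of [J], read through [special_actM]. *)
Lemma rho_clifford : clifford E A B.
Proof.
have spM : special (sval M) := svalP M.
have bl := (bm_bilin (sval M)).2.
have actZ k a v : bm_act (k *: a) v = k *: bm_act a v :> sval M.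
  by have := bl v k a 0; rewrite (bilin0l _ (bm_bilin _)) !addr0.
have actB a b v : bm_act (a - b) v = bm_act a v - bm_act b v :> sval M.
  by have := bl v (-1) b a; rewrite !scaleN1r addrC [- _ + _]addrC.
have half : 2^-1 != 0 :> F by rewrite invr_eq0 pnatr_eq0.
split=> v; rewrite !rhoE !linearZ /=.
- have := special_actM v spM gen_e_part gen_e_part.
  rewrite jmul_ee scale1r => eeE; rewrite [in RHS]eeE;
  by lin_field.
- have := special_actM v spM gen_e_part (gen_a_part s).
  rewrite jmul_ea scale1r actZ => /(canRL (scalerK half)) eaE; rewrite [in RHS]eaE.
  by lin_field.
- have := special_actM v spM gen_e_part (gen_b_part s).
  rewrite jmul_eb scale1r actZ => /(canRL (scalerK half)) eaE; rewrite [in RHS]eaE.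
  by lin_field.
have := special_actM v spM (gen_a_part s) (gen_b_part s).
rewrite jmul_ab actB actZ spM scaleN1r => /eqP.
rewrite subr_eq => /eqP abE; rewrite abE;
by lin_field.
Qed.

End Special.

Lemma rho_part (M : bimodule J) p q (a : J) (v : M) :
  a \in part J p -> v \in part M q -> rho M a v \in part M (p (+) q).
Proof. by move=> Ja Mv; rewrite rhoE rpredZ // bm_parity. Qed.

Lemma rho_morphism s (M N : special_cat J) (f : 'Hom(sval M, sval N)) :
    (forall p v, v \in part (sval M) p -> f v \in part (sval N) p) ->
    (forall v, f (rho _ gen_e v) = rho _ gen_e (f v)) ->
    (forall v, f (rho _ (gen_a s) v) = rho _ (gen_a s) (f v)) ->
    (forall v, f (rho _ (gen_b s) v) = rho _ (gen_b s) (f v)) ->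
  bimod_morphism f.
Proof.
move=> f_part fE fA fB; split=> // m v.
have two : 2 != 0 :> F by rewrite pnatr_eq0.
have un a : f (rho _ a v) = rho _ a (f v) -> f (bm_act a v) = bm_act a (f v).
  by rewrite !rhoE linearZ => /(scalerI two).
have mE (K : special_cat J) (w : sval K) : bm_act m w
    = (m 0 0 - m 1 1) *: bm_act gen_e w + m 1 1 *: bm_act (jone J) w
      + coef_a s m *: bm_act (gen_a s) w + coef_b s m *: bm_act (gen_b s) w.
  have bl := (bm_bilin (sval K)).2 w.
  have blD a b : bm_act (a + b) w = bm_act a w + bm_act b w.
    by have := bl 1 a b; rewrite !scale1r.
  have blZ k a : bm_act (k *: a) w = k *: bm_act a w.
    by have := bl k a 0; rewrite (bilin0l _ (bm_bilin _)) !addr0.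
  by rewrite {1}(m11_basis s m) !blD !blZ.
rewrite !mE !linearD !linearZ /= (un _ (fE v)) (un _ (fA v)) (un _ (fB v)).
by rewrite (svalP M) (svalP N) linearZ.
Qed.

End M11Rep.

(** * Special bimodules from operators *)

Section OperatorBimodule.
Variables (F : numFieldType) (V : superspace F) (s : bool) (E A B : 'End(V)).
Local Notation J := (m11_plus F).
Hypothesis cl : clifford E A B.
Hypothesis E_part : forall p v, v \in part V p -> E v \in part V p.
Hypothesis A_part : forall p v, v \in part V p -> A v \in part V (~~ p).
Hypothesis B_part : forall p v, v \in part V p -> B v \in part V (~~ p).

(** The action for which [E], [A] and [B] are twice the action of [gen_e],
    [gen_a s] and [gen_b s]. *)
Definition m11_act (m : J) (v : V) : V :=
  2^-1 *: (m 0 0 *: E v + m 1 1 *: (v - E v)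
           + coef_a s m *: A v + coef_b s m *: B v).

Lemma m11_act_bilin : bilin m11_act.
Proof.
split=> [m|v] k x y; rewrite /m11_act.
  by rewrite ?lfun_lin; lin_field.
by rewrite /coef_a /coef_b; case: s;
  rewrite !mxE ?lfun_lin; lin_field.
Qed.

Lemma m11_act_part p q (m : J) v :
  m \in part J p -> v \in part V q -> m11_act m v \in part V (p (+) q).
Proof.
rewrite mem_m11_part /m11_act /coef_a /coef_b => mp Vv; apply: rpredZ.
case: p mp => /andP[/eqP m1 /eqP m2]; case: s;
  rewrite m1 m2 ?oppr0 !scale0r ?addr0 ?add0r; apply: rpredD; apply: rpredZ.
all: by rewrite ?A_part ?B_part ?rpredB ?E_part.
Qed.

Lemma m11_actM p q (a d : J) v :
    a \in part J p -> d \in part J q ->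
  m11_act (jmul a d) v
  = m11_act a (m11_act d v) + (-1) ^+ (p && q) *: m11_act d (m11_act a v).
Proof.
have [EE EA EB AB] := cl => Ja Jd; rewrite /m11_act /coef_a /coef_b.
rewrite !(jmulE _ _ Ja Jd); move: Ja Jd; rewrite !mem_m11_part.
by case: p => /andP[/eqP -> /eqP ->]; case: q => /andP[/eqP -> /eqP ->];
  case: s;
  rewrite !(EE, EA, EB, AB, lfun_lin); lin_field.
Qed.

Lemma m11_act1 v : m11_act (jone J) v = 2^-1 *: v.
Proof.
rewrite /m11_act /coef_a /coef_b; congr (_ *: _).
by case: s; rewrite !mxE /= ?oppr0 !scale0r !scale1r !addr0 addrC subrK.
Qed.

Definition op_ob : special_cat J :=
  special_ob m11_act_bilin m11_act_part m11_actM m11_act1.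

Lemma rho_op_e v : rho (sval op_ob) (gen_e F) v = E v.
Proof.
rewrite rhoE /= /m11_act /coef_a /coef_b.
by case: s; rewrite !mxE /=; lin_field.
Qed.

Lemma rho_op_a v : rho (sval op_ob) (gen_a F s) v = A v.
Proof.
rewrite rhoE /= /m11_act /coef_a /coef_b /gen_a.
by case: s; rewrite !mxE /=; lin_field.
Qed.

Lemma rho_op_b v : rho (sval op_ob) (gen_b F s) v = B v.
Proof.
rewrite rhoE /= /m11_act /coef_a /coef_b /gen_b.
by case: s; rewrite !mxE /=; lin_field.
Qed.

End OperatorBimodule.

(** * Modules over the polynomial ring in two variables *)

Section PolyModule.
Variables (F : fieldType) (V : vectType F) (X Y : 'End(V)).
Hypothesis XY : forall v, X (Y v) = Y (X v).
Local Notation i0 := (0 : 'I_2).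
Local Notation i1 := (1 : 'I_2).

Definition mono_act (m : 'X_{1..2}) : 'End(V) :=
  (lfun_iter (m i0) X \o lfun_iter (m i1) Y)%VF.

Lemma mono_actE m v : mono_act m v = iter (m i0) X (iter (m i1) Y v).
Proof. by rewrite comp_lfunE !lfun_iterE. Qed.

Lemma mono_actD m1 m2 v :
  mono_act (m1 + m2)%MM v = mono_act m1 (mono_act m2 v).
Proof.
rewrite !mono_actE !mnmDE !iterD; congr (iter _ X _).
have XkY k w : Y (iter k X w) = iter k X (Y w) by apply: iter_comm.
by elim: (m1 i1) => //= k IHk; rewrite -XkY IHk.
Qed.

Definition poly_act (p : {mpoly F[2]}) (v : V) : V :=
  \sum_(m <- msupp p) p@_m *: mono_act m v.

Lemma poly_act_wide k p v : (msize p <= k)%N ->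
  poly_act p v = \sum_(m : 'X_{1..2 < k}) p@_m *: mono_act m v.
Proof.
move=> le_pk; rewrite /poly_act (big_mksub 'X_{1..2 < k}) ?msupp_uniq //=.
  by rewrite big_rmcond //= => j /memN_msupp_eq0 ->; rewrite scale0r.
by move=> m /msize_mdeg_lt /leq_trans; apply.
Qed.

Lemma poly_act_bilin : bilin poly_act.
Proof.
split=> [p|v] k u w.
  rewrite /poly_act scaler_sumr -big_split; apply: eq_bigr => m _ /=.
  by rewrite linearP scalerDr !scalerA mulrC.
pose n := maxn (msize (k *: u + w)) (maxn (msize u) (msize w)).
rewrite !(@poly_act_wide n) ?leq_max ?leqnn ?orbT //.
rewrite scaler_sumr -big_split; apply: eq_bigr => m _ /=.
by rewrite mcoeffD mcoeffZ scalerDl scalerA.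
Qed.

Lemma poly_actX m v : poly_act 'X_[m] v = mono_act m v.
Proof. by rewrite /poly_act msuppX big_seq1 mcoeffX eqxx scale1r. Qed.

Lemma poly_act1 v : poly_act 1 v = v.
Proof. by rewrite -mpolyX0 poly_actX mono_actE !mnm0E. Qed.

Lemma poly_actM p q v : poly_act (p * q) v = poly_act p (poly_act q v).
Proof.
have [_ actl] := poly_act_bilin.
have actD a b : poly_act (a + b) v = poly_act a v + poly_act b v.
  by have := actl v 1 a b; rewrite !scale1r.
have act0 : poly_act 0 v = 0 by apply: bilin0l poly_act_bilin.
have actZ k a : poly_act (k *: a) v = k *: poly_act a v.
  by have := actl v k a 0; rewrite act0 !addr0.
rewrite mpolyME (big_morph (poly_act^~ v) actD act0) big_allpairs /=.
apply: eq_bigr => m1 _; rewrite [poly_act q v]/poly_act linear_sum scaler_sumr.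
by apply: eq_bigr => m2 _; rewrite actZ poly_actX linearZ mono_actD scalerA.
Qed.

Definition poly_module : fdmodule {mpoly F[2]} :=
  FdModule poly_act_bilin poly_act1 poly_actM.

Lemma poly_module_X v : fm_act ('X_i0 : {mpoly F[2]}) (v : poly_module) = X v.
Proof. by rewrite /= poly_actX mono_actE !mnm1E. Qed.

Lemma poly_module_Y v : fm_act ('X_i1 : {mpoly F[2]}) (v : poly_module) = Y v.
Proof. by rewrite /= poly_actX mono_actE !mnm1E. Qed.

End PolyModule.

Section PolyMorphism.
Variables (F : fieldType) (n : nat) (N N' : fdmodule {mpoly F[n]}).

(** The polynomials whose actions are intertwined by [f] form a subalgebra. *)
Lemma poly_morphism (f : 'Hom(N, N')) :
    (forall i v, f (fm_act ('X_i : {mpoly F[n]}) v)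
                 = fm_act ('X_i : {mpoly F[n]}) (f v)) ->
  fdmod_morphism f.
Proof.
move=> fX; pose S p := forall v, f (fm_act p v) = fm_act p (f v).
have S1 : S 1 by move=> v; rewrite !fm_act1.
have SM p q : S p -> S q -> S (p * q).
  by move=> Sp Sq v; rewrite !fm_actM Sp Sq.
have SX m : S 'X_[m].
  rewrite mpolyXE_id; elim/big_ind: _ => // i _.
  by elim: (m i) => [|k IHk]; rewrite ?expr0 // exprS; apply: SM.
have SD p q : S p -> S q -> S (p + q).
  move=> Sp Sq v; have := (fm_bilin N).2 v 1 p q.
  have := (fm_bilin N').2 (f v) 1 p q.
  by rewrite !scale1r => -> ->; rewrite lfun_linD Sp Sq.
have S0 : S 0 by move=> v; rewrite !(bilin0l _ (fm_bilin _)) linear0.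
have SZ k p : S p -> S (k *: p).
  move=> Sp v; have := (fm_bilin N).2 v k p 0.
  have := (fm_bilin N').2 (f v) k p 0.
  by rewrite !addr0 !(bilin0l _ (fm_bilin _)) !addr0 => -> ->; rewrite lfun_linZ Sp.
by move=> p; rewrite [p]mpolyE; elim/big_ind: _ => // m _; apply/SZ/SX.
Qed.

End PolyMorphism.

HB.instance Definition _ (F : fieldType) (A : algType F) (N : fdmodule A) (a : A) :=
  GRing.isLinear.Build F N N *:%R (fm_act a) ((fm_bilin N).1 a).

(** * From polynomial modules to special bimodules *)

Section Doubling.
Variables (F : numFieldType) (s p : bool) (x0 y0 : F).
Local Notation A2 := {mpoly F[2]}.
Local Notation J := (m11_plus F).

Section Ob.
Variable N : fdmodule A2.

Definition shiftX : 'End(N) :=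
  (linfun (fm_act ('X_(0 : 'I_2) : A2)) + x0 *: \1)%VF.
Definition shiftY : 'End(N) :=
  (linfun (fm_act ('X_(1 : 'I_2) : A2)) + y0 *: \1)%VF.

Lemma shiftXE v : shiftX v = fm_act ('X_(0 : 'I_2) : A2) v + x0 *: v.
Proof. by rewrite add_lfunE scale_lfunE id_lfunE lfunE. Qed.

Lemma shiftYE v : shiftY v = fm_act ('X_(1 : 'I_2) : A2) v + y0 *: v.
Proof. by rewrite add_lfunE scale_lfunE id_lfunE lfunE. Qed.

Lemma shiftXY v : shiftX (shiftY v) = shiftY (shiftX v).
Proof.
rewrite !(shiftXE, shiftYE) !linearD !linearZ /= -!fm_actM mulrC.
by lin_field.
Qed.

Definition double_part (q : bool) : {vspace (N * N)%type} :=
  lker (linfun (if q == p then snd else fst : N * N -> N)).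

Lemma mem_double_part q (w : N * N) :
  (w \in double_part q) = ((if q == p then w.2 else w.1) == 0).
Proof. by rewrite /double_part; case: (q == p); rewrite memv_ker lfunE. Qed.

Lemma double_cap : (double_part false :&: double_part true = 0)%VS.
Proof.
apply/eqP; rewrite -subv0; apply/subvP => -[u v].
rewrite memv_cap !mem_double_part memv0 /=.
by case: p => /= /andP[/eqP -> /eqP ->].
Qed.

Lemma double_add : (double_part false + double_part true = fullv)%VS.
Proof.
apply/eqP; rewrite eqEsubv subvf; apply/subvP => -[u v] _; apply/memv_addP.
exists (if p then (0, v) else (u, 0)).
  by rewrite mem_double_part; case: p.
exists (if p then (u, 0) else (0, v)).
  by rewrite mem_double_part; case: p.
by case: p; congr (_, _); rewrite /= ?addr0 ?add0r.
Qed.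

Definition double : superspace F := SuperSpace double_cap double_add.

(** Where B maps the part E M isomorphically onto the other part, it may be used
    to identify them, which gives the second component of [double_b]; its first
    component and the second one of [double_a] are then called y and x, and
    A B - B A = 1 on E M leaves 1 + x y as the only choice for the last entry. *)
Definition double_e : 'End(double) :=
  linfun (fun w : N * N => (w.1, 0) : N * N).
Definition double_a : 'End(double) :=
  linfun (fun w : N * N => (w.2 + shiftX (shiftY w.2), shiftX w.1) : N * N).
Definition double_b : 'End(double) :=
  linfun (fun w : N * N => (shiftY w.2, w.1) : N * N).

Lemma double_eE (w : double) : double_e w = (w.1, 0).
Proof.
rewrite /double_e linfunE // => k u v.
by congr (_, _); rewrite /= scaler0 addr0.
Qed.

Lemma double_aE (w : double) :
  double_a w = (w.2 + shiftX (shiftY w.2), shiftX w.1).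
Proof.
rewrite /double_a linfunE // => k u v; congr (_, _); rewrite /= !lfun_lin //.
by lin_field.
Qed.

Lemma double_bE (w : double) : double_b w = (shiftY w.2, w.1).
Proof.
by rewrite /double_b linfunE // => k u v; congr (_, _); rewrite /= !lfun_lin.
Qed.

Lemma double_clifford : clifford double_e double_a double_b.
Proof.
split=> -[u v]; rewrite !(double_eE, double_aE, double_bE) /=; congr (_, _) => /=;
  rewrite ?linear0 ?shiftXY; by lin_field.
Qed.

Lemma double_e_part q w : w \in part double q -> double_e w \in part double q.
Proof.
rewrite !mem_double_part double_eE.
by case: (q == p) => //= /eqP ->.
Qed.

Lemma double_a_part q w :
  w \in part double q -> double_a w \in part double (~~ q).
Proof.
rewrite !mem_double_part double_aE.
by case: q p => [] [] /= /eqP ->; rewrite ?linear0 ?addr0.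
Qed.

Lemma double_b_part q w :
  w \in part double q -> double_b w \in part double (~~ q).
Proof.
rewrite !mem_double_part double_bE.
by case: q p => [] [] /= /eqP ->; rewrite ?linear0 ?addr0.
Qed.

Definition double_ob : special_cat J :=
  op_ob s double_clifford double_e_part double_a_part double_b_part.

Lemma rho_double_e (w : double) : rho (sval double_ob) (gen_e F) w = (w.1, 0).
Proof. by rewrite rho_op_e double_eE. Qed.

Lemma rho_double_a (w : double) :
  rho (sval double_ob) (gen_a F s) w = (w.2 + shiftX (shiftY w.2), shiftX w.1).
Proof. by rewrite rho_op_a double_aE. Qed.

Lemma rho_double_b (w : double) :
  rho (sval double_ob) (gen_b F s) w = (shiftY w.2, w.1).
Proof. by rewrite rho_op_b double_bE. Qed.

End Ob.

Section Map.
Variables (N N' : fdmodule A2).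

Definition double_fun (f : 'Hom(N, N')) : 'Hom(double N, double N') :=
  linfun (fun w : N * N => (f w.1, f w.2) : N' * N').

Lemma double_funE f (w : double N) : double_fun f w = (f w.1, f w.2).
Proof.
by rewrite /double_fun linfunE // => k u v; congr (_, _); rewrite /= linearP.
Qed.

Lemma double_morphism (f : fdmod_hom N N') :
  @bimod_morphism F J (sval (double_ob N)) (sval (double_ob N'))
    (double_fun (submod_val f)).
Proof.
have fm := submod_ofP f; move: (submod_val f) fm => {}f fm.
have fX v : f (shiftX N v) = shiftX N' (f v).
  by rewrite !shiftXE linearD linearZ /= fm.
have fY v : f (shiftY N v) = shiftY N' (f v).
  by rewrite !shiftYE linearD linearZ /= fm.
apply: (@rho_morphism F s (double_ob N) (double_ob N')) => [q w|w|w|w].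
- rewrite !mem_double_part double_funE.
  by case: (q == p) => /= /eqP ->; rewrite linear0.
- by rewrite !rho_double_e !double_funE /= linear0.
- by rewrite !rho_double_a !double_funE /= lfun_linD !fX fY.
by rewrite !rho_double_b !double_funE /= fY.
Qed.

Definition double_map (f : fdmod_hom N N') :
    hom (double_ob N : special_cat J) (double_ob N') :=
  special_hom (M := double_ob N) (N := double_ob N') (double_morphism f).

Lemma double_mapE f (w : double N) :
  submod_val (double_map f) w = (submod_val f w.1, submod_val f w.2).
Proof. exact: double_funE. Qed.

Lemma double_map_inj : injective double_map.
Proof.
move=> f g fg; apply/val_inj/lfunP => v.
have := double_mapE f (v, 0); rewrite fg double_mapE => -[+ _].
by move=> /esym.
Qed.

(** A morphism commutes with [gen_e] and [gen_b], hence is diagonal with equal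
    components; commuting with [gen_b] and [gen_a] then makes this component
    linear over the polynomials. *)
Lemma double_map_full (f : hom (double_ob N : special_cat J) (double_ob N')) :
  exists g, double_map g = f.
Proof.
have [_ fa] := submod_ofP f.
have frho a w : submod_val f (rho _ a w) = rho _ a (submod_val f w).
  by rewrite !rhoE linearZ /= fa.
pose fv (w : double N) : double N' := submod_val f w.
have fvE w : submod_val f w = fv w by [].
pose g := (linfun (fst : double N' -> N') \o submod_val f
           \o linfun (fun u : N => (u, 0) : double N))%VF.
have gE u : g u = (fv (u, 0)).1.
  rewrite !comp_lfunE lfunE /= linfunE // => k v w.
  by congr (_, _); rewrite /= scaler0 addr0.
have f1 u : fv (u, 0) = (g u, 0).
  have := frho (gen_e F) (u, 0).
  by rewrite rho_double_e fvE rho_double_e gE.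
have f2 v : fv (0, v) = (0, g v).
  have := frho (gen_b F s) (v, 0).
  by rewrite !rho_double_b !fvE /= f1 linear0 /= linear0.
have gX v : g (shiftX N v) = shiftX N' (g v).
  have := frho (gen_a F s) (v, 0).
  by rewrite !rho_double_a !fvE /= f1 /= !linear0 !addr0 f2 => -[].
have gY v : g (shiftY N v) = shiftY N' (g v).
  have := frho (gen_b F s) (0, v).
  by rewrite !rho_double_b !fvE /= f2 /= f1 => -[].
have gm : fdmod_morphism g.
  apply: poly_morphism => i v.
  have gx w : g (fm_act ('X_(0 : 'I_2) : A2) w) = fm_act ('X_(0 : 'I_2) : A2) (g w).
    by have := gX w; rewrite !shiftXE lfun_linD lfun_linZ => /addIr.
  have gy w : g (fm_act ('X_(1 : 'I_2) : A2) w) = fm_act ('X_(1 : 'I_2) : A2) (g w).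
    by have := gY w; rewrite !shiftYE lfun_linD lfun_linZ => /addIr.
  by move: i; apply: ord2_cases.
exists (mk_submod_of (S := fdmod_submod N N') gm).
apply: special_homP => -[u v]; rewrite double_mapE /=.
have -> : ((u, v) : double N) = (u, 0) + (0, v).
  by congr (_, _); rewrite /= ?addr0 ?add0r.
rewrite linearD /= !fvE f1 f2.
by congr (_, _); rewrite /= ?addr0 ?add0r.
Qed.

End Map.
End Doubling.

(** * Recognizing doubled modules *)

Lemma special_iso (F : numFieldType) (J : unital_jordan F) (M N : special_cat J)
    (f : hom M N) (g : 'Hom(sval N, sval M)) :
  cancel (submod_val f) g -> cancel g (submod_val f) -> isomorphic M N.
Proof.
move=> fK gK; have [fp fa] := submod_ofP f.
have gP : bimod_morphism g.
  split=> [q w Nw|a w].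
    suff <- : hcomp (sval M) q (g w) = g w by apply: hcomp_part.
    by apply: (can_inj fK); rewrite (hcomp_even fp) gK hcomp_id.
  by apply: (can_inj fK); rewrite gK fa gK.
exists f, (special_hom gP); split; apply: special_homP => v;
  by rewrite special_compE special_idE /=.
Qed.

Lemma inv_lfun_comm (F : fieldType) (V : vectType F) (f g : 'End(V)) v :
  lker f == 0%VS -> (forall w, g (f w) = f (g w)) ->
  g ((f^-1)%VF v) = (f^-1)%VF (g v).
Proof.
move=> kf fg; rewrite -[in RHS](lker0_lfunVK kf v) fg.
by rewrite lker0_lfunK.
Qed.

Section Recognize.
Variables (F : numFieldType) (s p : bool) (x0 y0 : F).
Local Notation A2 := {mpoly F[2]}.
Local Notation J := (m11_plus F).
Variable M : special_cat J.
Local Notation E := (rho (sval M) (gen_e F)).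
Local Notation A := (rho (sval M) (gen_a F s)).
Local Notation B := (rho (sval M) (gen_b F s)).
Local Notation W := (opW A B).
Local Notation Wi := (W^-1)%VF.

Hypothesis E_hcomp : forall v, E v = hcomp (sval M) p v.
Hypothesis W_inj : lker W == 0%VS.
Hypothesis X_nilp : nilp (fun v => Wi (A (A v)) - x0 *: v).
Hypothesis Y_nilp : nilp (fun v => B (B v) - y0 *: v).

Let cl : clifford E A B := rho_clifford s M.
Let U := part (sval M) p.

Lemma in_part_p v : (v \in U) = (E v == v).
Proof.
rewrite E_hcomp; apply/idP/eqP => [Uv|<-]; first by rewrite hcomp_id.
exact: hcomp_part.
Qed.

Definition restr (f : 'End(sval M)) : 'End(subvs_of U) :=
  (linfun (vsproj U) \o f \o linfun vsval)%VF.

Lemma restrE (f : 'End(sval M)) u : (forall v, E (f v) = f (E v)) ->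
  vsval (restr f u) = f (vsval u).
Proof.
move=> Ef; rewrite !comp_lfunE !lfunE /= vsprojK // in_part_p Ef.
by have := subvsP u; rewrite in_part_p => /eqP ->.
Qed.

(** The coordinates x = W^-1 A^2 and y = B^2, centred at the point. *)
Definition localX : 'End(sval M) := ((Wi \o (A \o A)) - x0 *: \1)%VF.
Definition localY : 'End(sval M) := ((B \o B) - y0 *: \1)%VF.

Lemma localXE v : localX v = Wi (A (A v)) - x0 *: v.
Proof. by rewrite add_lfunE opp_lfunE scale_lfunE id_lfunE !comp_lfunE. Qed.

Lemma localYE v : localY v = B (B v) - y0 *: v.
Proof. by rewrite add_lfunE opp_lfunE scale_lfunE id_lfunE !comp_lfunE. Qed.

Lemma Wi_E v : E (Wi v) = Wi (E v).
Proof. by apply: inv_lfun_comm W_inj _ => w; apply: opW_E. Qed.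

Lemma Wi_B v : B (Wi v) = Wi (B v).
Proof. by apply: inv_lfun_comm W_inj _ => w; apply: (opW_B cl). Qed.

Lemma localX_E v : E (localX v) = localX (E v).
Proof. by rewrite !localXE !lfun_lin Wi_E (sqrA_E cl). Qed.

Lemma localY_E v : E (localY v) = localY (E v).
Proof. by rewrite !localYE !lfun_lin (sqrB_E cl). Qed.

Lemma localXY v : localX (localY v) = localY (localX v).
Proof.
rewrite !(localXE, localYE) !lfun_lin !Wi_B !(sqrA_B cl).
by lin_field.
Qed.

Lemma restr_comm v : restr localX (restr localY v) = restr localY (restr localX v).
Proof.
apply: val_inj => /=.
rewrite !(restrE _ localX_E, restrE _ localY_E).
exact: localXY.
Qed.

Definition local_module : fdmodule A2 := poly_module restr_comm.

Lemma local_module_nilp :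
  acts_nilpotently local_module 'X_(0 : 'I_2)
  /\ acts_nilpotently local_module 'X_(1 : 'I_2).
Proof.
have restr_nil (f : 'End(sval M)) (g : local_module -> local_module) :
    (forall v, E (f v) = f (E v)) -> (forall u, g u = restr f u) -> nilp f ->
    exists n, forall v, iter n g v = 0.
  move=> Ef gE [k fk]; exists k => v; rewrite (eq_iter gE); apply: val_inj.
  rewrite /= -[RHS](fk (vsval v)); elim: k {fk} => //= k IHk.
  by rewrite restrE // IHk.
split.
  apply: (restr_nil _ _ localX_E); first exact: poly_module_X.
  by have [k fk] := X_nilp; exists k => v; rewrite (eq_iter localXE).
apply: (restr_nil _ _ localY_E); first exact: poly_module_Y.
by have [k fk] := Y_nilp; exists k => v; rewrite (eq_iter localYE).
Qed.

Local Notation D := (double_ob s p x0 y0 local_module).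

Lemma shiftX_local u : vsval (shiftX x0 local_module u) = Wi (A (A (vsval u))).
Proof.
rewrite shiftXE poly_module_X /= restrE; last exact: localX_E.
by rewrite localXE subrK.
Qed.

Lemma shiftY_local u : vsval (shiftY y0 local_module u) = B (B (vsval u)).
Proof.
rewrite shiftYE poly_module_Y /= restrE; last exact: localY_E.
by rewrite localYE subrK.
Qed.

Lemma E_local (u : local_module) : E (vsval u) = vsval u.
Proof. by have := subvsP u; rewrite in_part_p => /eqP. Qed.

Lemma E_B_local (u : local_module) : E (B (vsval u)) = 0.
Proof. by have [_ _ EB _] := cl; rewrite EB E_local subrr. Qed.

(** The part of parity [p] is the module, and the other one is identified with
    it along [B], which is invertible there with inverse W^-1 [A]. *)
Definition glue : 'Hom(sval D, sval M) :=
  linfun (fun w : local_module * local_module => vsval w.1 + B (vsval w.2)).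

Lemma glueE (w : sval D) : glue w = vsval w.1 + B (vsval w.2).
Proof.
rewrite /glue linfunE // => k u v; rewrite /= !lfun_lin.
by lin_field.
Qed.

Lemma glue_morphism : @bimod_morphism F J (sval D) (sval M) glue.
Proof.
have [_ EA EB _] := cl.
apply: (@rho_morphism F s D M) => [q w|[u v]|[u v]|[u v]].
- rewrite mem_double_part glueE.
  have [-> /eqP ->|ne_qp /eqP ->] := eqVneq q p.
    by rewrite /= !linear0 addr0; apply: subvsP.
  rewrite linear0 add0r (_ : q = true (+) p); last by case: q p ne_qp => [] [].
  by apply: rho_part (gen_b_part F s) _; apply: subvsP.
- rewrite rho_double_e !glueE /= !linear0 addr0 !lfun_lin.
  by rewrite E_local E_B_local addr0.
- rewrite rho_double_a !glueE /= !lfun_lin !shiftX_local shiftY_local.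
  rewrite Wi_B (BA_opW0 cl); last by rewrite EA E_local subrr.
  rewrite (AB_opW cl (E_local v)) (central_quadric cl) !lfun_lin.
  (* This is W = 1 + x y, that is W^-1 (W^2 - W) = W - 1. *)
  rewrite !lker0_lfunK // [_ + A _]addrC; congr (_ + _).
  by rewrite addrC subrK.
rewrite rho_double_b !glueE /= !lfun_lin shiftY_local.
by rewrite addrC.
Qed.

Definition unglue : 'Hom(sval M, sval D) :=
  linfun (fun w : sval M =>
    (vsproj U (E w), vsproj U (Wi (A (w - E w)))) : local_module * local_module).

Lemma unglueE w : unglue w = (vsproj U (E w), vsproj U (Wi (A (w - E w)))).
Proof.
rewrite /unglue linfunE // => k u v.
have -> : k *: u + v - E (k *: u + v) = k *: (u - E u) + (v - E v).
  by rewrite !lfun_lin; lin_field.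
by congr (_, _); rewrite /= !linearP.
Qed.

Lemma recognize_double : isomorphic (D : special_cat J) M.
Proof.
have [EE EA EB _] := cl.
apply: (@special_iso F J D M (special_hom (M := D) (N := M) glue_morphism) unglue).
  move=> [u v]; have Eu : E (vsval u + B (vsval v)) = vsval u.
    by rewrite lfun_linD E_local E_B_local addr0.
  rewrite /= unglueE glueE /= Eu.
  rewrite [vsval u + _]addrC addrK (AB_opW cl (E_local v)).
  by rewrite lker0_lfunK // !vsvalK.
move=> w; rewrite /= unglueE glueE /= !vsprojK ?in_part_p ?EE //; last first.
  by rewrite Wi_E EA !lfun_linD !lfun_linN EE subrr linear0 subr0.
rewrite Wi_B (BA_opW0 cl); last by rewrite !lfun_lin EE subrr.
by rewrite lker0_lfunK // addrC subrK.
Qed.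

End Recognize.

(** * Nonzero morphisms between nilpotent modules *)

Lemma nilp_kernel (V : nmodType) (f : V -> V) v :
    (exists k, iter k f v = 0) -> v != 0 ->
  exists j, iter j f v != 0 /\ f (iter j f v) = 0.
Proof.
move=> [k fk] nzv; have ex0 : exists k, iter k f v == 0 by exists k; apply/eqP.
case: (ex_minnP ex0) => -[|j] /eqP fj0 jmin; first by rewrite -fj0 eqxx in nzv.
exists j; split; last exact: fj0.
by apply/negP => /jmin; rewrite ltnn.
Qed.

Section NilpotentHom.
Variable F : fieldType.
Local Notation A2 := {mpoly F[2]}.
Local Notation xx := ('X_(0 : 'I_2) : A2).
Local Notation yy := ('X_(1 : 'I_2) : A2).

Lemma fm_actC (N : fdmodule A2) (a b : A2) (v : N) :
  fm_act a (fm_act b v) = fm_act b (fm_act a v).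
Proof. by rewrite -!fm_actM mulrC. Qed.

Lemma nilpotent_socle (N : fdmodule A2) :
    acts_nilpotently N xx -> acts_nilpotently N yy -> (exists v : N, v != 0) ->
  exists w : N, [/\ w != 0, fm_act xx w = 0 & fm_act yy w = 0].
Proof.
move=> [k xk] [l yl] [v nzv].
have [i [nzi xi]] := nilp_kernel (ex_intro _ k (xk v)) nzv.
have [j [nzj yj]] := nilp_kernel (ex_intro _ l (yl _)) nzi.
exists (iter j (fm_act yy) (iter i (fm_act xx) v)); split=> //.
rewrite iter_comm => [|w]; last by rewrite fm_actC.
by rewrite xi; elim: j {nzj yj} => //= j ->; rewrite linear0.
Qed.

(** Nakayama: for the image I of [e], the hypothesis gives I = x I + y I, hence
    I = x^j I + y I for all j, hence I = y I as x is nilpotent, hence I = 0. *)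
Lemma nilpotent_radical (N : fdmodule A2) (e : fdmod_hom N N) :
    acts_nilpotently N xx -> acts_nilpotently N yy ->
    (forall v, submod_val e (submod_val e v) = submod_val e v) ->
    (forall v, exists a b, submod_val e v = fm_act xx a + fm_act yy b) ->
  forall v, submod_val e v = 0.
Proof.
move=> [k xk] [l yl]; have em := submod_ofP e.
move: (submod_val e) em => {}e em ee rad.
have decx v j : e v = v ->
    exists a b, [/\ e a = a, e b = b & v = iter j (fm_act xx) a + fm_act yy b].
  elim: j v => [|j IHj] v ev.
    by exists v, 0; rewrite !linear0 addr0.
  have [a [b [ea eb ->]]] := IHj v ev.
  have [a' [b' ea']] := rad a; rewrite ea in ea'.
  have def_a : a = fm_act xx (e a') + fm_act yy (e b').
    by rewrite -{1}ea ea' linearD /= !em.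
  exists (e a'), (iter j (fm_act xx) (e b') + b); split=> //.
    by rewrite linearD /= eb iter_comm ?ee // => w; rewrite em.
  have yX : fm_act yy (iter j (fm_act xx) (e b'))
      = iter j (fm_act xx) (fm_act yy (e b')).
    by apply: iter_comm => w; rewrite fm_actC.
  have XD u w : iter j (fm_act xx) (u + w)
      = iter j (fm_act xx) u + iter j (fm_act xx) w.
    by elim: j {IHj yX} => //= j ->; rewrite linearD.
  by rewrite [fm_act yy (_ + _)]linearD /= yX addrA -iterS iterSr -XD -def_a.
have decy v j : e v = v -> exists2 b, e b = b & v = iter j (fm_act yy) b.
  move=> ev; elim: j => [|j [b eb vE]]; first by exists v.
  have [a [b' [_ eb' bE]]] := decx b k eb.
  by exists b' => //; rewrite iterSr -[fm_act yy b']add0r -(xk a) -bE.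
by move=> v; have [b _ ->] := decy _ l (ee v).
Qed.

(** Compose a functional which vanishes on the radical of [N], but not on the
    image of [e], with the inclusion of a line of the socle of [N']. *)
Lemma nilpotent_nonzero_hom (N N' : fdmodule A2) (e : fdmod_hom N N) :
    acts_nilpotently N xx -> acts_nilpotently N yy ->
    acts_nilpotently N' xx -> acts_nilpotently N' yy ->
    (exists v : N', v != 0) ->
    (forall v, submod_val e (submod_val e v) = submod_val e v) ->
    (forall g : fdmod_hom N N', forall v, submod_val g (submod_val e v) = 0) ->
  forall v, submod_val e v = 0.
Proof.
move=> Nx Ny N'x N'y nzN' ee all0.
have [w [nzw xw yw]] := nilpotent_socle N'x N'y nzN'.
apply: (nilpotent_radical Nx Ny ee) => v.
pose R := (limg (linfun (fm_act xx : N -> N)) + limg (linfun (fm_act yy : N -> N)))%VS.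
have [/memv_addP[_ /memv_imgP[a _ ->] [_ /memv_imgP[b _ ->] ->]]|notR] :=
    boolP (submod_val e v \in R).
  by exists a, b; rewrite !lfunE.
pose pr := (\1 - projv R)%VF.
have prE u : pr u = u - projv R u by rewrite add_lfunE opp_lfunE id_lfunE.
have prR u : u \in R -> pr u = 0 by move=> Ru; rewrite prE projv_id // subrr.
have nzpr : pr (submod_val e v) != 0.
  apply: contra notR; rewrite prE subr_eq0 => /eqP ->; exact: memv_proj.
have [i nzi] : exists i, coord (vbasis {:N}) i (pr (submod_val e v)) != 0.
  apply: contrapT => all_0; case/eqP: nzpr.
  rewrite (coord_vbasis (memvf (pr (submod_val e v)))) big1 // => i _.
  have [->|nz] := eqVneq (coord (vbasis {:N}) i (pr (submod_val e v))) 0.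
    by rewrite scale0r.
  by case: all_0; exists i.
pose g : 'Hom(N, N') := linfun (fun u : N => coord (vbasis {:N}) i (pr u) *: w).
have gE u : g u = coord (vbasis {:N}) i (pr u) *: w.
  by rewrite /g linfunE // => k u1 u2; rewrite !linearP scalerDl scalerA.
have gm : fdmod_morphism g.
  apply: poly_morphism => j u; rewrite !gE linearZ /=.
  have R0 : fm_act xx u \in R.
    by apply: subvP (addvSl _ _) _ _; rewrite -(lfunE (fm_act xx)) memv_img ?memvf.
  have R1 : fm_act yy u \in R.
    by apply: subvP (addvSr _ _) _ _; rewrite -(lfunE (fm_act yy)) memv_img ?memvf.
  move: j; apply: ord2_cases.
    by rewrite (prR _ R0) linear0 scale0r xw scaler0.
  by rewrite (prR _ R1) linear0 scale0r yw scaler0.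
have := all0 (mk_submod_of (S := fdmod_submod N N') gm) v.
rewrite /= gE => /eqP; rewrite scaler_eq0 (negPf nzw) orbF.
by rewrite (negPf nzi).
Qed.

End NilpotentHom.

(** * The blocks *)

Lemma block_nonzero (F : numFieldType) (J : unital_jordan F)
    (B : special_cat J -> Prop) :
  is_block B -> exists M : special_cat J, B M /\ exists v : sval M, v != 0.
Proof.
move=> [_ [nz _]]; apply: contrapT => all0; apply: nz => -[M BM].
apply/(zero_special M) => v; apply: contrapT => /eqP nzv.
by apply: all0; exists M; split=> //; exists v.
Qed.

Section BlockInvariants.
Variable F : numClosedFieldType.
Local Notation J := (m11_plus F).
Variable B : special_cat J -> Prop.
Hypothesis blk : is_block B.
Local Notation rE M := (rho (sval M) (gen_e F)).
Local Notation rA s M := (rho (sval M) (gen_a F s)).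
Local Notation rB s M := (rho (sval M) (gen_b F s)).
Local Notation rW s M := (opW (rA s M) (rB s M)).

Lemma hom_rho (M N : special_cat J) (f : hom M N) a v :
  submod_val f (rho _ a v) = rho _ a (submod_val f v).
Proof. by have [_ fa] := submod_ofP f; rewrite !rhoE linearZ /= fa. Qed.

Lemma hom_hcomp (M N : special_cat J) (f : hom M N) q v :
  submod_val f (hcomp _ q v) = hcomp _ q (submod_val f v).
Proof. by have [fp _] := submod_ofP f; apply: hcomp_even. Qed.

Lemma hom_opW (M N : special_cat J) (f : hom M N) s v :
  submod_val f (rW s M v) = rW s N (submod_val f v).
Proof. by rewrite !opWE !lfun_lin !hom_rho. Qed.

Lemma hcomp_e (M : special_cat J) q v :
  rE M (hcomp _ q v) = hcomp _ q (rE M v).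
Proof.
apply: (@hcomp_even _ (sval M) (sval M)) => r w.
exact: rho_part (gen_e_part F).
Qed.

Lemma hcomp_odd (M : special_cat J) (a : J) q v : a \in part J true ->
  hcomp _ q (rho (sval M) a v) = rho (sval M) a (hcomp _ (~~ q) v).
Proof.
move=> Ja; rewrite -[in LHS](hcompD v q) !linearD /=.
rewrite !(hcompE _ (rho_part Ja (hcomp_part _ _))).
by case: q; rewrite /= ?addr0 ?add0r.
Qed.

Lemma central_morphism s (M : special_cat J) (f : 'End(sval M)) :
    (forall q v, f (hcomp _ q v) = hcomp _ q (f v)) ->
    (forall v, rE M (f v) = f (rE M v)) ->
    (forall v, rA s M (f v) = f (rA s M v)) ->
    (forall v, rB s M (f v) = f (rB s M v)) ->
  bimod_morphism f.
Proof.
move=> fh fE fA fB; apply: (@rho_morphism F s M M) => // q v Mv.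
by rewrite -(hcomp_id Mv) fh hcomp_part.
Qed.

Lemma hcomp_opW s (M : special_cat J) q v :
  rW s M (hcomp _ q v) = hcomp _ q (rW s M v).
Proof.
rewrite !opWE !lfun_lin.
by rewrite !hcomp_odd ?gen_a_part ?gen_b_part // negbK.
Qed.

(** The parity of a homogeneous vector and its eigenvalue for 2 [gen_e] - 1 both
    change sign under the odd generators, so that the product of these two signs
    is a central operator; on a block it is constant. *)
Lemma block_parity : exists p, forall M, B M -> forall v, rE M v = hcomp _ p v.
Proof.
pose sg (M : special_cat J) : 'End(sval M) :=
  (hcomp (sval M) false - hcomp (sval M) true)%VF.
pose c (M : special_cat J) : 'End(sval M) := ((2 *: rE M - \1) \o sg M)%VF.
have sgE M v : sg M v = hcomp _ false v - hcomp _ true v.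
  by rewrite add_lfunE opp_lfunE.
have cE M v : c M v = 2 *: rE M (sg M v) - sg M v.
  by rewrite comp_lfunE add_lfunE opp_lfunE scale_lfunE id_lfunE.
have sg_e M v : rE M (sg M v) = sg M (rE M v).
  by rewrite !sgE !lfun_lin !hcomp_e.
have hh (M : special_cat J) q r v :
    hcomp (sval M) q (hcomp _ r v) = if q == r then hcomp _ r v else 0.
  exact/hcompE/hcomp_part.
have sgK M v : sg M (sg M v) = v.
  by rewrite !sgE !lfun_lin !hh /= subr0 sub0r opprK (hcompD v false).
have sg_odd M a v : a \in part J true -> sg M (rho _ a v) = - rho _ a (sg M v).
  by move=> Ja; rewrite !sgE !hcomp_odd //= !lfun_lin opprB addrC.
have cK M v : c M (c M v) = v.
  have [EE _ _ _] := rho_clifford false M.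
  rewrite !cE !lfun_lin -!sg_e !sgK ?EE.
  by lin_field.
have c_mor M : bimod_morphism (c M).
  have [EE EA EB _] := rho_clifford false M.
  apply: (@central_morphism false) => [q v|v|v|v]; rewrite !cE.
  - have -> : sg M (hcomp (sval M) q v) = hcomp _ q (sg M v).
      by rewrite !sgE !lfun_lin !hh; case: q.
    by rewrite hcomp_e !lfun_lin.
  - by rewrite !lfun_lin !sg_e.
  - rewrite sg_odd ?gen_a_part // !lfun_lin EA.
    by lin_field.
  rewrite sg_odd ?gen_b_part // !lfun_lin EB.
  by lin_field.
have c_nat (M N : special_cat J) (f : hom M N) v :
    B M -> B N -> submod_val f (c M v) = c N (submod_val f v).
  by move=> _ _; rewrite !cE !lfun_lin hom_rho !sgE !lfun_lin !hom_hcomp.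
have [a aP] := block_eigenvalue blk (fun M _ => c_mor M) c_nat.
have aa : a * a = 1.
  have [M [BM [v nzv]]] := block_nonzero blk; have [k ck] := aP M BM.
  have [j [nzj /eqP]] := nilp_kernel (ex_intro _ k (ck v)) nzv.
  set w := iter j _ v in nzj *; rewrite subr_eq0 => /eqP cw.
  have := cK M w; rewrite cw linearZ /= cw scalerA => /eqP.
  rewrite -subr_eq0 -{2}[w]scale1r -scalerBl scaler_eq0 (negPf nzj) orbF.
  by rewrite subr_eq0 => /eqP.
have ca M v : B M -> c M v = a *: v.
  move=> BM; have [k ck] := aP M BM.
  (* As [c] is an involution and [a] a sign, [c] - [a] acts on its image by
     - 2 [a]; being nilpotent, it vanishes. *)
  pose u := c M v - a *: v.
  have cu : c M u = - a *: u.
    rewrite /u linearB linearZ /= cK scalerBr scalerA mulNr aa !scaleNr scale1r.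
    by rewrite opprK addrC.
  have iter_u j : iter j (fun w => c M w - a *: w) u = (- a - a) ^+ j *: u.
    elim: j => [|j IHj]; first by rewrite scale1r.
    rewrite iterS IHj linearZ /= cu exprS !scalerA -scalerBl.
    by congr (_ *: _); ring.
  apply/eqP; rewrite -subr_eq0 -/u; have := ck u; rewrite iter_u => /eqP.
  rewrite scaler_eq0 expf_eq0 => /orP[/andP[_]|//].
  have nza : a != 0 by apply/eqP => a0; move/eqP: aa; rewrite a0 mul0r eq_sym oner_eq0.
  rewrite -opprD oppr_eq0 -mulr2n mulrn_eq0 /=.
  by rewrite (negPf nza).
have two : 2 != 0 :> F by rewrite pnatr_eq0.
have [a1|a1] : a = 1 \/ a = -1.
  have : (a - 1) * (a + 1) == 0 by rewrite -subr_sqr expr2 aa expr1n subrr.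
  by rewrite mulf_eq0 subr_eq0 addr_eq0 => /orP[]/eqP; [left | right].
- exists false => M BM v; apply: (scalerI two).
  have := ca M (sg M v) BM; rewrite cE sgK a1 scale1r => /eqP; rewrite subr_eq => /eqP ->.
  rewrite sgE -[X in _ + X](hcompD v false) /=.
  by lin_field.
exists true => M BM v; apply: (scalerI two).
have := ca M (sg M v) BM; rewrite cE sgK a1 => /eqP; rewrite subr_eq => /eqP ->.
rewrite sgE -[X in _ + X](hcompD v false) /=.
by lin_field.
Qed.

Lemma nilp_eigenvalue (V : vectType F) (f : 'End(V)) (a b : F) v :
  nilp (fun w => f w - a *: w) -> f v = b *: v -> b != a -> v = 0.
Proof.
move=> [k fk] fv ne_ba; apply/eqP; have := fk v.
have -> : iter k (fun w => f w - a *: w) v = (b - a) ^+ k *: v.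
  elim: k {fk} => [|k IHk]; first by rewrite scale1r.
  rewrite iterS IHk linearZ /= fv exprS !scalerA -scalerBl.
  by congr (_ *: _); ring.
by move/eqP; rewrite scaler_eq0 expf_eq0 subr_eq0 (negPf ne_ba) andbF.
Qed.

(** [W] is [a] plus a nilpotent on the whole block, so that it is invertible
    unless [a] = 0, in which case 1 - [W] is; this is [W] in the other chart. *)
Lemma block_chart : exists s, forall M, B M -> lker (rW s M) == 0%VS.
Proof.
have [a aP] : exists a : F, forall M, B M -> nilp (fun v => rW false M v - a *: v).
  apply: (@block_eigenvalue _ _ _ (fun M => rW false M) blk) => [M _|M N f v _ _].
    have cl := rho_clifford false M.
    apply: (@central_morphism false) => [q v|v|v|v].
    - exact: hcomp_opW.
    - exact: (opW_E cl).
    - exact: (opW_A cl).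
    exact: (opW_B cl).
  exact: hom_opW.
have inj (s : bool) (M : special_cat J) : (forall v, rW s M v = 0 -> v = 0) ->
    lker (rW s M) == 0%VS.
  move=> W0; rewrite -subv0; apply/subvP=> v; rewrite memv_ker memv0 => /eqP.
  by move/W0/eqP.
have WT M v : rW true M v = v - rW false M v.
  rewrite !opWE /gen_a /gen_b.
  have rhoN (m : J) w : rho (sval M) (- m) w = - rho (sval M) m w.
    rewrite !rhoE; have := (bm_bilin (sval M)).2 w (-1) m 0.
    by rewrite !scaleN1r (bilin0l _ (bm_bilin _)) !addr0 => ->; rewrite scalerN.
  rewrite !rhoN !lfun_lin.
  by lin_field.
have [a0|nza] := eqVneq a 0.
  exists true => M BM; apply: (inj true M) => v; rewrite WT => /eqP.
  rewrite subr_eq0 => /eqP Wv; apply: (nilp_eigenvalue (aP M BM) (b := 1)).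
    by rewrite scale1r -Wv.
  by rewrite a0 oner_eq0.
exists false => M BM; apply: (inj false M) => v Wv.
by apply: (nilp_eigenvalue (aP M BM) (b := 0)); rewrite ?scale0r // eq_sym.
Qed.

Section Chart.
Variable s : bool.
Hypothesis W_inj : forall M, B M -> lker (rW s M) == 0%VS.

Lemma block_Y : exists y0 : F, forall M, B M ->
  nilp (fun v => rB s M (rB s M v) - y0 *: v).
Proof.
pose c (M : special_cat J) := (rB s M \o rB s M)%VF.
have cE M v : c M v = rB s M (rB s M v) by rewrite comp_lfunE.
have [M BM|M N f v _ _|y0 y0P] := @block_eigenvalue _ _ _ c blk.
- have cl := rho_clifford s M.
  apply: (@central_morphism s) => [q v|v|v|v]; rewrite !cE //.
  + by rewrite !hcomp_odd ?gen_b_part // negbK.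
  + exact: (sqrB_E cl).
  exact: (sqrB_A cl).
- by rewrite !cE !hom_rho.
by exists y0 => M BM; have [k ck] := y0P M BM; exists k => v;
  rewrite -[RHS](ck v); apply: eq_iter => w; rewrite cE.
Qed.

Lemma block_X : exists x0 : F, forall M, B M ->
  nilp (fun v => ((rW s M)^-1)%VF (rA s M (rA s M v)) - x0 *: v).
Proof.
pose c (M : special_cat J) := ((rW s M)^-1 \o (rA s M \o rA s M))%VF.
have cE M v : c M v = ((rW s M)^-1)%VF (rA s M (rA s M v)).
  by rewrite !comp_lfunE.
have [M BM|M N f v BM BN|x0 x0P] := @block_eigenvalue _ _ _ c blk.
- have cl := rho_clifford s M.
  have WiC (g : 'End(sval M)) w : (forall v, g (rW s M v) = rW s M (g v)) ->
      g (((rW s M)^-1)%VF w) = ((rW s M)^-1)%VF (g w).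
    exact: (inv_lfun_comm _ (W_inj BM)).
  apply: (@central_morphism s) => [q v|v|v|v]; rewrite !cE.
  + rewrite WiC => [|w]; last by rewrite hcomp_opW.
    by rewrite !hcomp_odd ?gen_a_part // negbK.
  + by rewrite WiC ?(sqrA_E cl) //; apply: (opW_E cl).
  + by rewrite WiC //; apply: (opW_A cl).
  by rewrite WiC ?(sqrA_B cl) //; apply: (opW_B cl).
- rewrite !cE -!hom_rho -[in RHS](lker0_lfunVK (W_inj BM) (rA s M (rA s M v))).
  by rewrite hom_opW lker0_lfunK ?W_inj.
by exists x0 => M BM; have [k ck] := x0P M BM; exists k => v;
  rewrite -[RHS](ck v); apply: eq_iter => w; rewrite cE.
Qed.

End Chart.
End BlockInvariants.

Section Main.
Variable F : numClosedFieldType.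
Local Notation J := (m11_plus F).
Variable B : special_cat J -> Prop.
Hypothesis blk : is_block B.
Variables (s p : bool) (x0 y0 : F).
Local Notation A2 := {mpoly F[2]}.
Local Notation D := (double_ob s p x0 y0).
Local Notation dmap := (double_map s p x0 y0).

Lemma double_map_linear (N N' : fdmodule A2) : linear (@dmap N N').
Proof.
move=> k f g; apply: special_homP => w.
by rewrite double_mapE /= !add_lfunE !scale_lfunE !double_funE.
Qed.

Lemma double_map1 (N : fdmodule A2) : dmap (fdmod_id N) = idm (D N : special_cat J).
Proof.
apply: special_homP => -[u v].
by rewrite double_mapE special_idE /= !id_lfunE.
Qed.

Lemma double_mapM (N N' N'' : fdmodule A2) (g : fdmod_hom N' N'')
    (f : fdmod_hom N N') :
  dmap (fdmod_comp g f) = comp (dmap g) (dmap f).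
Proof.
apply: special_homP => w; rewrite special_compE !double_mapE /=.
by rewrite !comp_lfunE.
Qed.

Hypothesis B_double : forall M, B M ->
  exists N : nilpotent_poly2_cat F, isomorphic (D (sval N) : special_cat J) M.

(** The component [Y] of the bimodule of [N] outside the block is cut out by an
    idempotent [e] of [N]. Were it nonzero, some morphism from [N] to a nonzero
    module [N1] coming from the block would not vanish on the image of [e], and
    would yield a nonzero morphism from [Y] to an object of the block. *)
Lemma double_in_block (N : nilpotent_poly2_cat F) : B (D (sval N)).
Proof.
have [[B' [rB _ _ hB'B dec]] _] := blk.
have [X [Y [BX BY bip]]] := dec (D (sval N)).
apply: (rB X) => //; apply: (biproduct_zero bip).
have [M [BM [v nzv]]] := block_nonzero blk.
have [N1 isoN1] := B_double BM.
have BN1 : B (D (sval N1)) by apply: rB BM; apply: isomorphic_sym.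
have nzN1 : exists w : sval N1, w != 0.
  apply: contrapT => all0; case/eqP: nzv.
  apply: (proj1 (zero_special M)); apply: isomorphic_zero isoN1 _.
  apply/(zero_special (D (sval N1))) => -[w1 w2].
  have w0 (w : sval N1) : w = 0 by apply: contrapT => /eqP nzw; apply: all0; exists w.
  by rewrite (w0 w1) (w0 w2).
case: bip => i1 [i2 [p1 [p2 [_ p22 _ _ _]]]].
have [e eE] := double_map_full (comp i2 p2).
have ee : fdmod_comp e e = e.
  apply: (@double_map_inj F s p x0 y0).
  by rewrite double_mapM eE -compA [comp p2 _]compA p22 comp1m.
have eev u : submod_val e (submod_val e u) = submod_val e u.
  by rewrite -[in RHS]ee /= comp_lfunE.
have [Nx Ny] := svalP N; have [N1x N1y] := svalP N1.
have e0 : forall u, submod_val e u = 0.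
  apply: (nilpotent_nonzero_hom Nx Ny N1x N1y nzN1 eev) => g u.
  have : comp (dmap g) (dmap e) = 0.
    by rewrite eE compA (hB'B _ _ (comp (dmap g) i2) BN1 BY) comp0m.
  move/(congr1 (fun h : hom (D (sval N) : special_cat J) (D (sval N1)) =>
    submod_val h (u, 0))).
  by rewrite special_compE !double_mapE special_hom0 => -[].
have dmap0 : dmap e = 0.
  by apply: special_homP => w; rewrite double_mapE special_hom0 !e0.
have : comp (comp p2 i2) (comp p2 i2) = 0.
  by rewrite -compA [comp i2 _]compA -eE dmap0 comp0m compm0.
by rewrite p22 comp1m.
Qed.

Definition block_functor : lfunctor (nilpotent_poly2_cat F) (fullsub B) :=
  @LFunctor F (nilpotent_poly2_cat F) (fullsub B)
    (fun N => exist _ (D (sval N) : special_cat J) (double_in_block N))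
    (fun N N' f => dmap f)
    (fun N N' => @double_map_linear (sval N) (sval N'))
    (fun N => double_map1 (sval N))
    (fun N N' N'' g f => double_mapM g f).

Lemma block_equivalent : equivalent (fullsub B) (nilpotent_poly2_cat F).
Proof.
apply: (equivalent_of_ff_ess_surj (H := block_functor)).
- by move=> N N'; apply: double_map_inj.
- by move=> N N' f; apply: double_map_full.
move=> [M BM]; have [N isoN] := B_double BM.
by exists N.
Qed.

End Main.

Lemma block_equivalent_nilpotent (F : numClosedFieldType)
    (B : special_cat (m11_plus F) -> Prop) :
  is_block B -> equivalent (fullsub B) (nilpotent_poly2_cat F).
Proof.
move=> blk; have [p Ep] := block_parity blk.
have [s Ws] := block_chart blk.
have [x0 Xs] := block_X blk Ws; have [y0 Ys] := block_Y blk s.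
apply: (@block_equivalent _ B blk s p x0 y0) => M BM.
have nil := local_module_nilp (Ep M BM) (Ws M BM) (Xs M BM) (Ys M BM).
exists (exist (fun N : fdmodule {mpoly F[2]} =>
    acts_nilpotently N 'X_(0 : 'I_2) /\ acts_nilpotently N 'X_(1 : 'I_2)) _ nil).
exact: recognize_double.
Qed.

Theorem theorem6p7 (R : realType) (B : special_cat (m11_plus R[i]%C) -> Prop) :
  is_block B ->
  equivalent (fullsub B) (nilpotent_poly2_cat R[i]%C).
Proof. exact: block_equivalent_nilpotent. Qed.
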